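(* There exists a family of c-connected flat clustered graphs $C(G,T)$ with planar underlying graph $G$ on $n$ vertices, for arbitrarily large $n$, such that $\alpha\in\Omega(n^2)$ in every $\langle\alpha,0,0\rangle$-drawing of $C(G,T)$.
   Context: A clustered graph $C(G,T)$ consists of a graph $G$ and a rooted tree $T$ whose leaves are exactly the vertices of $G$; each internal node $\mu$ of $T$ is a cluster, identified with the set of leaves of its subtree. $C(G,T)$ is c-connected if for every cluster the subgraph of $G$ induced by its vertices is connected; it is flat if no cluster other than the root contains another cluster. A drawing of $C(G,T)$ maps vertices to distinct points, edges to open curves between their endpoints, and each cluster $\mu$ to a simple closed region $R(\mu)$ containing all and only the vertices of $\mu$, with $R(\nu)\supseteq R(\mu)$ whenever $\mu$ is a descendant of $\nu$. Intersections among curves are isolated points, no three curves meet at a point, and two curves alternate around each intersection point. Edge-edge crossings are crossings between two edges; an edge crossing the boundary of $R(\mu)$ exactly $k$ times contributes $\lfloor k/2\rfloor$ edge-region crossings; for clusters $\mu,\nu$ neither an ancestor of the other, the number of region-region crossings is the number of connected components of $R(\mu)\setminus R(\nu)$ minus one. An $\langle\alpha,0,0\rangle$-drawing is a drawing with exactly $\alpha$ edge-edge crossings and no edge-region or region-region crossings. *)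

(* Defs.v *)
From HB Require Import structures.
From mathcomp Require Import all_boot all_order all_algebra.
From mathcomp Require Import all_classical all_reals all_analysis.

Set Implicit Arguments.
Unset Strict Implicit.
Unset Printing Implicit Defensive.

Import Order.TTheory GRing.Theory Num.Theory.
Import numFieldNormedType.Exports.

Record sgraph := SGraph {
  vertex :> finType;
  adj : rel vertex;
  adj_sym : symmetric adj;
  adj_irr : irreflexive adj }.

Definition edges (G : sgraph) : {set {set G}} :=
  [set [set p.1; p.2] | p : G * G & adj p.1 p.2]%SET.

Definition induced_connected (G : sgraph) (S : {set G}) : Prop :=
  {in S &, forall u v,
    connect [rel x y : G | [&& x \in S, y \in S & adj x y]] u v}.

(* The tree is given by its parent function, the root being its own parent;
   [rt_reach] makes the root the only cyclic point of [parent]. *)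
Record rtree := RTree {
  node :> finType;
  root : node;
  parent : node -> node;
  parent_root : parent root = root;
  rt_reach : forall x, fconnect parent x root }.

(* Reflexive: every node is an ancestor of itself. *)
Definition ancestor (T : rtree) (x y : T) : bool := fconnect (@parent T) y x.

Definition is_leaf (T : rtree) (x : T) : bool :=
  [forall y : T, (y != root T) ==> (parent y != x)].

Record clustered_graph := ClusteredGraph {
  cgraph :> sgraph;
  ctree : rtree;
  leaf_of : cgraph -> ctree;
  leaf_of_inj : injective leaf_of;
  leaf_ofP : forall x : ctree, is_leaf x = (x \in codom leaf_of) }.

Definition is_cluster (C : clustered_graph) (mu : ctree C) : bool :=
  ~~ is_leaf mu.

Definition cluster_vertices (C : clustered_graph) (mu : ctree C) : {set C} :=
  [set v : C | ancestor mu (leaf_of v)]%SET.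

Definition c_connected (C : clustered_graph) : Prop :=
  forall mu : ctree C, is_cluster mu ->
    induced_connected (cluster_vertices mu).

Definition flat (C : clustered_graph) : Prop :=
  forall mu nu : ctree C, is_cluster mu -> is_cluster nu ->
    mu != root (ctree C) -> ancestor mu nu -> nu = mu.

Local Open Scope classical_set_scope.
Local Open Scope card_scope.
Local Open Scope ring_scope.

Section Plane.
Variable R : realType.
Local Notation plane := (R * R)%type.
Implicit Types (g : R -> plane) (A B : set plane) (p : plane).

Definition simple_arc g : Prop :=
  {within `[0, 1], continuous g} /\
  {in `[0, 1] &, injective g}.

Definition simple_closed_curve g : Prop :=
  [/\ {within `[0, 1], continuous g}, g 0 = g 1 &
      {in `[0, 1[ &, injective g}].

Definition open_trace g : set plane := g @` `]0, 1[.
Definition closed_trace g : set plane := g @` `[0, 1].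

Definition inside g : set plane :=
  [set p | ~ closed_trace g p /\
           bounded_set (connected_component (~` closed_trace g) p)].

Definition closed_region g : set plane := closed_trace g `|` inside g.

(* Circular order around p: every neighbourhood of p contains a simple closed
   curve winding around p which meets A and B in exactly four points, in the
   cyclic order A, B, A, B. *)
Definition alternate A B p : Prop :=
  forall U : set plane, nbhs p U ->
  exists c : R -> plane, exists t0 t1 t2 t3 : R,
    [/\ simple_closed_curve c,
        closed_trace c `<=` U,
        inside c p,
        [/\ 0 <= t0, t0 < t1, t1 < t2, t2 < t3 & t3 < 1] &
        closed_trace c `&` A = [set c t0; c t2] /\
        closed_trace c `&` B = [set c t1; c t3]].

Definition components A : set (set plane) :=
  [set connected_component A x | x in A].

Record graph_drawing (G : sgraph) := GraphDrawing {
  pos : G -> plane;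
  arc : {set G} -> R -> plane;
  pos_inj : injective pos;
  arc_simple : forall e, e \in edges G -> simple_arc (arc e);
  arc_ends : forall e, e \in edges G ->
    exists u v : G, [/\ e = [set u; v]%SET, arc e 0 = pos u & arc e 1 = pos v];
  arc_avoids : forall e, e \in edges G ->
    forall v : G, ~ open_trace (arc e) (pos v) }.

Definition planar (G : sgraph) : Prop :=
  exists d : graph_drawing G, forall e f,
    e \in edges G -> f \in edges G -> e != f ->
    open_trace (arc d e) `&` open_trace (arc d f) = set0.

(* The curves constrained by general position are the edges and the boundaries of the
   regions. *)
Definition curve_index (C : clustered_graph) := ({set C} + ctree C)%type.

Definition is_curve (C : clustered_graph) (i : curve_index C) : bool :=
  match i with inl e => e \in edges C | inr mu => is_cluster mu end.

Definition curve (C : clustered_graph) (d : graph_drawing C)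
    (bd : ctree C -> R -> plane) (i : curve_index C) : set plane :=
  match i with
  | inl e => open_trace (arc d e)
  | inr mu => closed_trace (bd mu)
  end.

Record drawing (C : clustered_graph) := Drawing {
  gdrawing :> graph_drawing C;
  bd : ctree C -> R -> plane;
  bd_simple : forall mu, is_cluster mu -> simple_closed_curve (bd mu);
  bd_avoids : forall mu, is_cluster mu ->
    forall v : C, ~ closed_trace (bd mu) (pos gdrawing v);
  region_vertices : forall mu, is_cluster mu -> forall v : C,
    closed_region (bd mu) (pos gdrawing v) <-> v \in cluster_vertices mu;
  region_nested : forall mu nu, is_cluster mu -> is_cluster nu ->
    ancestor nu mu -> closed_region (bd mu) `<=` closed_region (bd nu);
  curves_isolated : forall i j : curve_index C,
    is_curve i -> is_curve j -> i != j ->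
    forall p, (curve gdrawing bd i `&` curve gdrawing bd j) p ->
    isolated (curve gdrawing bd i `&` curve gdrawing bd j) p;
  curves_no_three : forall i j k : curve_index C,
    is_curve i -> is_curve j -> is_curve k -> i != j -> i != k -> j != k ->
    curve gdrawing bd i `&` curve gdrawing bd j `&` curve gdrawing bd k = set0;
  curves_alternate : forall i j : curve_index C,
    is_curve i -> is_curve j -> i != j ->
    forall p, (curve gdrawing bd i `&` curve gdrawing bd j) p ->
    alternate (curve gdrawing bd i) (curve gdrawing bd j) p }.

Definition region (C : clustered_graph) (d : drawing C) (mu : ctree C) :=
  closed_region (bd d mu).

(* By [curves_no_three] each such point lies on a single pair of edges, and by
   [curves_alternate] each is a crossing. *)
Definition edge_edge_points (C : clustered_graph) (d : drawing C) :
    set plane :=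
  [set p | exists e f : {set C},
    [/\ e \in edges C, f \in edges C, e != f,
        open_trace (arc d e) p & open_trace (arc d f) p]].

Definition edge_edge_crossings (C : clustered_graph) (d : drawing C)
    (a : nat) : Prop :=
  edge_edge_points d #= `I_a.

Definition edge_region_crossings (C : clustered_graph) (d : drawing C)
    (e : {set C}) (mu : ctree C) (b : nat) : Prop :=
  exists k : nat,
    (open_trace (arc d e) `&` closed_trace (bd d mu) #= `I_k) /\ b = k./2.

Definition region_region_crossings (C : clustered_graph) (d : drawing C)
    (mu nu : ctree C) (c : nat) : Prop :=
  components (region d mu `\` region d nu) #= `I_c.+1.

Definition drawing_a00 (C : clustered_graph) (d : drawing C) (a : nat) : Prop :=
  [/\ edge_edge_crossings d a,
      forall e mu, e \in edges C -> is_cluster mu ->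
        edge_region_crossings d e mu 0 &
      forall mu nu, is_cluster mu -> is_cluster nu ->
        ~~ ancestor mu nu -> ~~ ancestor nu mu ->
        region_region_crossings d mu nu 0].

End Plane.

(* Main.v *)
(* G is K5 minus the edge o0 o1, with each of the nine remaining edges replaced by
   p parallel paths of length two, p prime; the only cluster besides the root
   consists of o2, o3, o4 and of the middle vertices of the paths between them.

   In a drawing without edge-region crossings, an edge inside the cluster meets the
   boundary of the region at most once, so both of its halves remain in the bounded
   component of their endpoint and the edge stays in the closed region.  The hubs o0
   and o1 lie in the unique unbounded component of the complement, hence are joined
   by a compact connected set disjoint from the region.  Choosing one path for each
   of the nine edges thus yields a topological drawing of K5 in which the edge o0 o1
   meets no independent edge, so two other independent paths must meet.  Choosing
   the path x + e y for the edge e, with x, y in F_p, makes the p^2 crossings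
   obtained in this way pairwise distinct.

   The nonplanarity of K5 is proved for compact connected sets: they are replaced by
   fine polygonal chains in general position, and the parity of the number of
   crossings between independent chains does not change when a chain is replaced by
   a segment, because the three edges independent of a given one form a closed
   polygon. *)
From HB Require Import structures.
From mathcomp Require Import all_boot all_order all_algebra.
From mathcomp Require Import all_classical all_reals all_analysis.
From mathcomp Require Import ring lra zify.
Require Import Defs.

Set Implicit Arguments.
Unset Strict Implicit.
Unset Printing Implicit Defensive.

Import Order.TTheory GRing.Theory Num.Theory.
Import numFieldNormedType.Exports.

Local Open Scope classical_set_scope.
Local Open Scope card_scope.
Local Open Scope ring_scope.

(** * Sums modulo 2 along paths, and orientations of triples *)

Section PathSum.
Variable X : eqType.
Implicit Types (F : X -> X -> bool) (x y : X) (l : seq X).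

(** [bool] serves as the field F_2, so [+] is exclusive or and sums count modulo 2. A path is its
    first vertex [x] together with the list [l] of the later ones. *)
Fixpoint path_sum F x l : bool :=
  if l is y :: l' then F x y + path_sum F y l' else 0.

Lemma path_sumD F H x l :
  path_sum (fun a b => F a b + H a b) x l = path_sum F x l + path_sum H x l.
Proof. by elim: l x => [|y l IH] x //=; rewrite IH; ring. Qed.

Lemma path_sum0 x l : path_sum (fun _ _ => 0) x l = 0.
Proof. by elim: l x => [|y l IH] x //=; rewrite IH. Qed.

Lemma eq_in_path_sum F H x l :
  {in x :: l &, forall a b, a != b -> F a b = H a b} -> uniq (x :: l) ->
  path_sum F x l = path_sum H x l.
Proof.
elim: l x => [|y l IH] x //= FH /andP[xyl uyl].
rewrite FH ?mem_head ?inE ?eqxx ?orbT //; last first.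
  by move: xyl; rewrite inE negb_or => /andP[].
by rewrite IH // => a b al bl; apply: FH; rewrite inE ?al ?bl orbT.
Qed.

(** Telescoping: every interior vertex contributes twice, hence 0 modulo 2. *)
Lemma path_sum_coboundary (w : X -> bool) x l :
  path_sum (fun a b => w a + w b) x l = w x + w (last x l).
Proof.
elim: l x => [|y l IH] x /=; first by case: (w x).
by rewrite IH; case: (w x); case: (w y); case: (w _).
Qed.

(** The relation on triples cuts off the second vertex, replacing the first two edges by one;
    iterating leaves the edge between the two ends. *)
Lemma path_sum_cocycle F x y l : uniq (x :: y :: l) ->
  {in x :: y :: l & &, forall a b c, uniq [:: a; b; c] -> F a b + F b c = F a c} ->
  path_sum F x (y :: l) = F x (last y l).
Proof.
elim: l y => [|z l IH] y; first by move=> _ _ /=; rewrite addr0.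
move=> u FC; have -> : path_sum F x [:: y, z & l] = path_sum F x (z :: l).
  rewrite /= addrA FC ?inE ?eqxx ?orbT //.
  by move: u; rewrite /= !inE !negb_or => /and3P[/and3P[-> -> _] /andP[-> _] _].
apply: IH.
  by move: u; rewrite /= !inE !negb_or => /and3P[/and3P[_ -> ->] _ ->].
have sub : {subset x :: z :: l <= x :: y :: z :: l}.
  by move=> a; rewrite !inE => /or3P[] ->; rewrite ?orbT.
by move=> a b c /sub ha /sub hb /sub hc; apply: FC.
Qed.

Definition path_pair_sum (K : X -> X -> X -> X -> bool) x l y m : bool :=
  path_sum (fun a b => path_sum (K a b) y m) x l.

Lemma path_pair_sumC (K : X -> X -> X -> X -> bool) x l y m :
  (forall a b c d, K a b c d = K c d a b) ->
  path_pair_sum K x l y m = path_pair_sum K y m x l.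
Proof.
move=> KC; rewrite /path_pair_sum; elim: l x => [|z l IH] x /=.
  by rewrite path_sum0.
rewrite IH path_sumD; congr (_ + _).
by elim: m y {IH} => [|t m IH] y //=; rewrite IH KC.
Qed.

Lemma path_sum_true F x l : path_sum F x l ->
  exists a b, F a b /\ exists l1 l2, x :: l = l1 ++ a :: b :: l2.
Proof.
elim: l x => [|y l IH] x //=.
case Fxy: (F x y); first by move=> _; exists x, y; split=> //; exists [::], l.
rewrite add0r => /IH [a [b [Fab [l1 [l2 e]]]]].
by exists a, b; split=> //; exists (x :: l1), l2; rewrite e.
Qed.
End PathSum.

(** Quantification over [n] booleans is made computable, so that an identity between ten signs is
    settled by evaluation. *)
Fixpoint bool_fun n : Type := if n is m.+1 then bool -> bool_fun m else bool.

Fixpoint bool_forall n : bool_fun n -> bool :=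
  if n is m.+1 return bool_fun n -> bool
  then fun f => bool_forall (f true) && bool_forall (f false) else id.

Lemma bool_forallS n (f : bool_fun n.+1) :
  bool_forall f -> forall b, bool_forall (f b).
Proof. by move=> /= /andP[ft ff] []. Qed.

Lemma bool_forall10 (f : bool_fun 10) : bool_forall f ->
  forall b0 b1 b2 b3 b4 b5 b6 b7 b8 b9, f b0 b1 b2 b3 b4 b5 b6 b7 b8 b9.
Proof.
move=> H b0 b1 b2 b3 b4 b5 b6 b7 b8 b9.
change (@bool_forall 0 (f b0 b1 b2 b3 b4 b5 b6 b7 b8 b9)).
by do 10!apply: bool_forallS.
Qed.

Section Orientation.
Variable R : realFieldType.
Implicit Types p q r s x y : R * R.

(** Twice the signed area of the triangle [p q r]. *)
Definition det3 p q r : R :=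
  (q.1 - p.1) * (r.2 - p.2) - (q.2 - p.2) * (r.1 - p.1).

Definition ccw p q r : bool := 0 < det3 p q r.

(** When no three of the four points are collinear, this says that the segments [pq] and [rs]
    cross. *)
Definition crosses p q r s : bool :=
  (ccw p q r != ccw p q s) && (ccw r s p != ccw r s q).

Lemma crossesC p q r s : crosses p q r s = crosses r s p q.
Proof. by rewrite /crosses andbC. Qed.

Lemma ccw_cycle p q r : ccw q r p = ccw p q r.
Proof. by rewrite /ccw; congr (0 < _); rewrite /det3; ring. Qed.

Lemma det3_swap p q r : det3 q p r = - det3 p q r.
Proof. by rewrite /det3; ring. Qed.

Lemma ccw_swap p q r : det3 p q r != 0 -> ccw q p r = ~~ ccw p q r.
Proof. by move=> n0; rewrite /ccw det3_swap oppr_gt0 -leNgt le_eqVlt (negPf n0). Qed.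

(** The arguments are the signs of the factors in a relation ab - cd + ef = 0, whose three terms can
    be neither all positive nor all negative. *)
Definition pluecker (a b c d e f : bool) : bool :=
  ~~ [&& a == b, c != d & e == f] && ~~ [&& a != b, c == d & e != f].

Lemma ccw_pluecker x p q r y :
  det3 x p q != 0 -> det3 x r y != 0 -> det3 x p r != 0 ->
  det3 x q y != 0 -> det3 x p y != 0 -> det3 x q r != 0 ->
  pluecker (ccw x p q) (ccw x r y) (ccw x p r) (ccw x q y)
           (ccw x p y) (ccw x q r).
Proof.
(* The three-term Grassmann-Plücker relation with base point [x]. *)
have : det3 x p q * det3 x r y - det3 x p r * det3 x q y
       + det3 x p y * det3 x q r = 0 by rewrite /det3; ring.
rewrite /ccw /pluecker.
move: (det3 x p q) (det3 x r y) (det3 x p r) (det3 x q y) (det3 x p y)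
  (det3 x q r) => a b c d e f E.
case: (ltrgt0P a) => // ha _; case: (ltrgt0P b) => // hb _;
case: (ltrgt0P c) => // hc _; case: (ltrgt0P d) => // hd _;
case: (ltrgt0P e) => // he _; case: (ltrgt0P f) => // hf _ //=; exfalso; nra.
Qed.

(** Comparing the three signs with each other covers both orientations of the triangle. *)
Definition in_triangle p q r x : bool :=
  (ccw p q x == ccw q r x) && (ccw q r x == ccw r p x).

Definition gen5 p q r x y := [&& [&& det3 p q r != 0, det3 p q x != 0,
  det3 p q y != 0, det3 p r x != 0 & det3 p r y != 0] &
  [&& det3 p x y != 0, det3 q r x != 0, det3 q r y != 0, det3 q x y != 0
    & det3 r x y != 0]].

Lemma ccw_perm p q r : det3 p q r != 0 ->
  (ccw q r p = ccw p q r) * (ccw r p q = ccw p q r) *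
  (ccw q p r = ~~ ccw p q r) * (ccw p r q = ~~ ccw p q r) *
  (ccw r q p = ~~ ccw p q r).
Proof.
move=> n0; have e := ccw_swap n0.
rewrite (ccw_cycle p q r) (ccw_cycle q r p) (ccw_cycle p q r).
by rewrite (ccw_cycle q p r) -(ccw_cycle r q p) e.
Qed.

Lemma det3_perm_neq0 p q r : det3 p q r != 0 ->
  (det3 q r p != 0) * (det3 r p q != 0) *
  (det3 q p r != 0) * (det3 p r q != 0) * (det3 r q p != 0).
Proof.
move=> n0.
have e1 : det3 q r p = det3 p q r by rewrite /det3; ring.
have e2 : det3 r p q = det3 p q r by rewrite /det3; ring.
have e3 : det3 q p r = - det3 p q r by rewrite /det3; ring.
have e4 : det3 p r q = - det3 p q r by rewrite /det3; ring.
have e5 : det3 r q p = - det3 p q r by rewrite /det3; ring.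
by rewrite e1 e2 e3 e4 e5 !oppr_eq0 n0.
Qed.

(** Each of the five points serves once as base point. The negations come from sorting every triple
    into the order [p], [q], [r], [x], [y], so that only ten signs occur. *)
Lemma gen5_pluecker p q r x y : gen5 p q r x y ->
  let c := ccw in
  [&& pluecker (c p q r) (c p x y) (c p q x) (c p r y) (c p q y) (c p r x),
      pluecker (~~ c p q r) (c q x y) (~~ c p q x) (c q r y)
               (~~ c p q y) (c q r x),
      pluecker (c p q r) (c r x y) (~~ c p r x) (~~ c q r y)
               (~~ c p r y) (~~ c q r x),
      pluecker (c p q x) (~~ c r x y) (c p r x) (~~ c q x y)
               (~~ c p x y) (c q r x) &
      pluecker (c p q y) (c r x y) (c p r y) (c q x y) (c p x y) (c q r y)].
Proof.
move=> /andP[/and5P[h1 h2 h3 h4 h5] /and5P[h6 h7 h8 h9 h10]] /=.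
pose P := (ccw_perm h1, ccw_perm h2, ccw_perm h3, ccw_perm h4, ccw_perm h5,
  ccw_perm h6, ccw_perm h7, ccw_perm h8, ccw_perm h9, ccw_perm h10).
pose Q := (h1, h2, h3, h4, h5, h6, h7, h8, h9, h10,
  (det3_perm_neq0 h1, det3_perm_neq0 h2, det3_perm_neq0 h3, det3_perm_neq0 h4,
   det3_perm_neq0 h5, det3_perm_neq0 h6, det3_perm_neq0 h7, det3_perm_neq0 h8,
   det3_perm_neq0 h9, det3_perm_neq0 h10)).
have a1 := @ccw_pluecker p q r x y.
have a2 := @ccw_pluecker q p r x y.
have a3 := @ccw_pluecker r p q x y.
have a4 := @ccw_pluecker x p q r y.
have a5 := @ccw_pluecker y p q r x.
apply/and5P; split.
- by apply: a1; rewrite !Q.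
- by move: a2; rewrite !P; apply; rewrite !Q.
- by move: a3; rewrite !P; apply; rewrite !Q.
- by move: a4; rewrite !P; apply; rewrite !Q.
- by move: a5; rewrite !P; apply; rewrite !Q.
Qed.

(** A segment changes sides whenever it crosses the boundary of the triangle. Both members depend
    only on the ten signs, and the identity is evaluated on all sign patterns, with [gen5_pluecker]
    as premise. *)
Lemma crosses_triangle p q r x y : gen5 p q r x y ->
  crosses p q x y + crosses q r x y + crosses p r x y
  = in_triangle p q r x + in_triangle p q r y.
Proof.
move=> g; have := gen5_pluecker g; move: g.
move=> /andP[/and5P[h1 h2 h3 h4 h5] /and5P[h6 h7 h8 h9 h10]] /=.
rewrite /crosses /in_triangle.
rewrite !(ccw_perm h1, ccw_perm h2, ccw_perm h3, ccw_perm h4, ccw_perm h5,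
  ccw_perm h6, ccw_perm h7, ccw_perm h8, ccw_perm h9, ccw_perm h10).
rewrite /pluecker.
move: (ccw p q r) (ccw p q x) (ccw p q y) (ccw p r x) (ccw p r y) (ccw p x y)
  (ccw q r x) (ccw q r y) (ccw q x y) (ccw r x y) =>
  b0 b1 b2 b3 b4 b5 b6 b7 b8 b9.
move=> H; apply/eqP; move: H; apply/implyP.
move: b0 b1 b2 b3 b4 b5 b6 b7 b8 b9.
by apply: (@bool_forall10 (fun b0 b1 b2 b3 b4 b5 b6 b7 b8 b9 => _)); vm_compute.
Qed.

(** The fifteen summands are the pairs of independent edges of a straight-line K5; the check over
    sign patterns is the same as for [crosses_triangle]. *)
Lemma straight_K5_odd p q r x y : gen5 p q r x y ->
  crosses p q r x + crosses p q r y + crosses p q x y +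
  (crosses p r q x + crosses p r q y + crosses p r x y) +
  (crosses p x q r + crosses p x q y + crosses p x r y) +
  (crosses p y q r + crosses p y q x + crosses p y r x) +
  (crosses q r x y + crosses q x r y + crosses q y r x) = 1.
Proof.
move=> g; have := gen5_pluecker g; move: g.
move=> /andP[/and5P[h1 h2 h3 h4 h5] /and5P[h6 h7 h8 h9 h10]] /=.
rewrite /crosses.
rewrite !(ccw_perm h1, ccw_perm h2, ccw_perm h3, ccw_perm h4, ccw_perm h5,
  ccw_perm h6, ccw_perm h7, ccw_perm h8, ccw_perm h9, ccw_perm h10).
rewrite /pluecker.
move: (ccw p q r) (ccw p q x) (ccw p q y) (ccw p r x) (ccw p r y) (ccw p x y)
  (ccw q r x) (ccw q r y) (ccw q x y) (ccw r x y) =>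
  b0 b1 b2 b3 b4 b5 b6 b7 b8 b9.
move=> H; apply/eqP; move: H; apply/implyP.
move: b0 b1 b2 b3 b4 b5 b6 b7 b8 b9.
by apply: (@bool_forall10 (fun b0 b1 b2 b3 b4 b5 b6 b7 b8 b9 => _)); vm_compute.
Qed.
End Orientation.

(** * Polygonal drawings of K5 *)

Section GenericPolygons.
Variables (R : realFieldType) (X : eqType) (Q : X -> R * R).
Hypothesis gen : forall a b c : X, uniq [:: a; b; c] ->
  det3 (Q a) (Q b) (Q c) != 0.

Definition seg_cross a b c d := crosses (Q a) (Q b) (Q c) (Q d).

Definition crossing_parity := path_pair_sum seg_cross.

Lemma crossing_parityC x l y m :
  crossing_parity x l y m = crossing_parity y m x l.
Proof. by apply: path_pair_sumC => a b c d; apply: crossesC. Qed.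

Lemma gen5_uniq a b c d e : uniq [:: a; b; c; d; e] ->
  gen5 (Q a) (Q b) (Q c) (Q d) (Q e).
Proof.
rewrite /= !inE !negb_or => /and5P[/and4P[ab ac ad ae] /and3P[bc bd be]].
move=> /andP[cd ce] de _.
by rewrite /gen5 !gen //= !inE !negb_or ?ab ?ac ?ad ?ae ?bc ?bd ?be ?cd ?ce ?de.
Qed.

(** Summing [crosses_triangle] over the edges of the path telescopes to its two ends. *)
Lemma path_cross_triangle a b c y m : uniq [:: a; b; c] -> uniq (y :: m) ->
  {in y :: m, forall d, d \notin [:: a; b; c]} ->
  path_sum (seg_cross a b) y m + path_sum (seg_cross b c) y m
    + path_sum (seg_cross a c) y m =
  in_triangle (Q a) (Q b) (Q c) (Q y)
    + in_triangle (Q a) (Q b) (Q c) (Q (last y m)).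
Proof.
move=> abc um dis; rewrite -!path_sumD.
rewrite -[RHS](path_sum_coboundary (fun z => in_triangle (Q a) (Q b) (Q c) (Q z))).
apply: eq_in_path_sum um => d e /dis dn /dis en de.
apply: crosses_triangle; apply: gen5_uniq.
move: abc dn en; rewrite /= !inE !negb_or ![d == _]eq_sym ![e == _]eq_sym eq_sym de.
by move=> /and3P[/andP[-> ->] -> _] /and3P[-> -> ->] /and3P[-> -> ->].
Qed.

(** The paths [f1], [f2], [f3] close up to a polygon. Its crossings with the sides of a triangle
    [a b c] sum to 0, since each of the three path ends enters [path_cross_triangle] twice; so the
    crossing count is a cocycle and [path_sum_cocycle] applies. *)
Lemma straighten_path x y l i j f1 f2 f3 :
  uniq (x :: y :: l) -> uniq (i :: f1) -> uniq (i :: f2) -> uniq (j :: f3) ->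
  last i f1 = j -> last i f2 = last j f3 ->
  {in x :: y :: l, forall d, [/\ d \notin i :: f1, d \notin i :: f2 & d \notin j :: f3]} ->
  let C := crossing_parity in
  C x (y :: l) i f1 + C x (y :: l) i f2 + C x (y :: l) j f3 =
  C x [:: last y l] i f1 + C x [:: last y l] i f2 + C x [:: last y l] j f3.
Proof.
move=> ul u1 u2 u3 e1 e2 dis C.
rewrite /C /crossing_parity /path_pair_sum -!path_sumD.
rewrite [LHS]path_sum_cocycle // ?[RHS]addr0 //.
move=> a b c /dis[a1 a2 a3] /dis[b1 b2 b3] /dis[c1 c2 c3] abc.
have N (m : seq X) : a \notin m -> b \notin m -> c \notin m ->
   {in m, forall d, d \notin [:: a; b; c]}.
  move=> am bm cm d dm; rewrite !inE !negb_or.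
  by apply/and3P; split; apply: contraTneq dm => ->.
have E1 := path_cross_triangle abc u1 (N _ a1 b1 c1).
have E2 := path_cross_triangle abc u2 (N _ a2 b2 c2).
have E3 := path_cross_triangle abc u3 (N _ a3 b3 c3).
move: E1 E2 E3; rewrite e1 e2.
do 3!case: (path_sum _ _ _); do 3!case: (path_sum _ _ _); 
do 3!case: (path_sum _ _ _); by do 3!case: in_triangle.
Qed.

Lemma crossing_parity_true x l y m : crossing_parity x l y m ->
  exists a b c d, [/\ seg_cross a b c d,
    exists l1 l2, x :: l = l1 ++ a :: b :: l2 &
    exists l1 l2, y :: m = l1 ++ c :: d :: l2].
Proof.
move=> /path_sum_true[a [b [/path_sum_true[c [d [K e2]]] e1]]].
by exists a, b, c, d.
Qed.
End GenericPolygons.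

Notation o0 := (@Ordinal 5 0 isT).
Notation o1 := (@Ordinal 5 1 isT).
Notation o2 := (@Ordinal 5 2 isT).
Notation o3 := (@Ordinal 5 3 isT).
Notation o4 := (@Ordinal 5 4 isT).

Section PolygonalK5.
Variables (R : realFieldType) (N : nat).
(** [inl i] is a vertex of K5 and [inr ((i, j), k)] the [k]-th interior vertex of the chain for the
    edge [ij]. [N] bounds all chain lengths; [n i j] is the number of interior vertices in use. *)
Let X := ('I_5 + ('I_5 * 'I_5) * 'I_N)%type.
Variables (Q : X -> R * R) (n : 'I_5 -> 'I_5 -> nat).
Hypothesis gen : forall a b c : X, uniq [:: a; b; c] ->
  det3 (Q a) (Q b) (Q c) != 0.

Definition poly_interior i j : seq X :=
  [seq inr ((i, j), k) | k <- take (n i j) (enum 'I_N)].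

(** The flag [g] replaces the chain by a segment. The start [inl i] is left out, in the format of
    [path_sum]. *)
Definition poly_path (g : bool) i j : seq X :=
  rcons (if g then [::] else poly_interior i j) (inl j).

Local Notation D g i j h k l :=
  (crossing_parity Q (inl i) (poly_path g i j) (inl k) (poly_path h k l)).

Lemma mem_poly_path g i j x : x \in inl i :: poly_path g i j ->
  [|| x == inl i, x == inl j | if x is inr (e, _) then e == (i, j) else false].
Proof.
rewrite inE mem_rcons inE => /or3P[->|->|]; rewrite ?orbT //.
by case: g => // /mapP[k _ ->]; rewrite eqxx orbT.
Qed.

Lemma uniq_poly_path g i j : i != j -> uniq (inl i :: poly_path g i j).
Proof.
move=> ij; rewrite /= rcons_uniq mem_rcons inE negb_or /=.
rewrite (inj_eq inl_inj) ij /=; case: g => //=.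
rewrite map_inj_uniq; last by move=> ? ? [].
rewrite take_uniq ?enum_uniq // andbT.
by apply/andP; split; apply/mapP => -[].
Qed.

Lemma poly_path_disjoint g h i j k l x : uniq [:: i; j; k; l] ->
  x \in inl i :: poly_path g i j -> x \notin inl k :: poly_path h k l.
Proof.
move=> u /mem_poly_path xi; apply/negP => /mem_poly_path.
move: u xi; rewrite /= !inE !negb_or.
case: x => [x|[[e1 e2] x]] /=.
  rewrite !orbF !(inj_eq inl_inj) => /and4P[/and3P[ij ik il] /andP[jk jl] kl _].
  move=> /orP[] /eqP->; apply/negP; rewrite negb_or; first by rewrite ik il.
  by rewrite jk jl.
move=> /and4P[/and3P[ij ik il] _ _ _] /eqP[-> ->] /eqP[e _].
by rewrite e eqxx in ik.
Qed.

Lemma straighten_K5 i j a b c g1 g2 g3 : uniq [:: i; j; a; b; c] ->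
  D false i j g1 a b + D false i j g2 a c + D false i j g3 b c =
  D true i j g1 a b + D true i j g2 a c + D true i j g3 b c.
Proof.
rewrite /= !inE !negb_or => /and5P[/and4P[ij ia ib ic] /and3P[ja jb jc] /andP[ab ac] bc _].
have L g k l : last (inl k) (poly_path g k l) = inl l by rewrite last_rcons.
have [y [m e]] : exists y m, poly_path false i j = y :: m.
  by rewrite /poly_path; case: (poly_interior i j) => [|y m]; do 2!eexists.
have -> : poly_path true i j = [:: last y m].
  by have := L false i j; rewrite e /= => ->.
rewrite e; apply: straighten_path => //; rewrite -?e ?uniq_poly_path ?L //.
move=> d dij; split; apply: poly_path_disjoint dij;
 by rewrite /= !inE !negb_or ?ij ?ia ?ib ?ic ?ja ?jb ?jc ?ab ?ac ?bc.
Qed.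

(** The fifteen pairs of independent edges; the flag [bij] tells whether the edge [ij] is already
    straight. *)
Definition K5_parity (b01 b02 b03 b04 b12 b13 b14 b23 b24 b34 : bool) : bool :=
  (D b01 o0 o1 b23 o2 o3 +
   D b01 o0 o1 b24 o2 o4 +
   D b01 o0 o1 b34 o3 o4) +
  (D b02 o0 o2 b13 o1 o3 +
   D b02 o0 o2 b14 o1 o4 +
   D b02 o0 o2 b34 o3 o4) +
  (D b03 o0 o3 b12 o1 o2 +
   D b03 o0 o3 b14 o1 o4 +
   D b03 o0 o3 b24 o2 o4) +
  (D b04 o0 o4 b12 o1 o2 +
   D b04 o0 o4 b13 o1 o3 +
   D b04 o0 o4 b23 o2 o3) +
  (D b12 o1 o2 b34 o3 o4 +
   D b13 o1 o3 b24 o2 o4 +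
   D b14 o1 o4 b23 o2 o3).

Lemma K5_parity_straight :
  K5_parity true true true true true true true true true true = 1.
Proof.
rewrite /K5_parity /crossing_parity /path_pair_sum /= !addr0.
have u : uniq [:: inl o0; inl o1; inl o2; inl o3; inl o4 : X] by [].
rewrite -(straight_K5_odd (gen5_uniq gen u)).
by rewrite /seg_cross; ring.
Qed.

(** The ten edges are straightened one after another. Only the three terms containing the current
    edge change, and [straighten_K5] preserves their sum. *)
Lemma K5_parity_odd :
  K5_parity false false false false false false false false false false = 1.
Proof.
rewrite -K5_parity_straight.
have C g i j h k l : D g i j h k l = D h k l g i j by apply: crossing_parityC.
(* Phrased as a difference, so that [ring] cancels the twelve unaffected terms. *)
have step i j a b c g1 g2 g3 s t : uniq [:: i; j; a; b; c] ->
  s - t = D false i j g1 a b + D false i j g2 a c + D false i j g3 b c -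
    (D true i j g1 a b + D true i j g2 a c + D true i j g3 b c) -> s = t.
  by move=> u; rewrite straighten_K5 // subrr => /eqP; rewrite subr_eq0 => /eqP.
transitivity (K5_parity true false false false false false false false false false).
  apply: (@step o0 o1 o2 o3 o4 false false false) => //.
  by rewrite /K5_parity; ring.
transitivity (K5_parity true true false false false false false false false false).
  apply: (@step o0 o2 o1 o3 o4 false false false) => //.
  by rewrite /K5_parity; ring.
transitivity (K5_parity true true true false false false false false false false).
  apply: (@step o0 o3 o1 o2 o4 false false false) => //.
  by rewrite /K5_parity; ring.
transitivity (K5_parity true true true true false false false false false false).
  apply: (@step o0 o4 o1 o2 o3 false false false) => //.
  by rewrite /K5_parity; ring.
transitivity (K5_parity true true true true true false false false false false).
  apply: (@step o1 o2 o0 o3 o4 true true false) => //.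
  (* From here on the current edge is the second one in some terms of [K5_parity]; symmetry brings
     both forms together. *)
  rewrite (C false o1 o2 _ o0 o3) (C true o1 o2 _ o0 o3)
    (C false o1 o2 _ o0 o4) (C true o1 o2 _ o0 o4).
  by rewrite /K5_parity; ring.
transitivity (K5_parity true true true true true true false false false false).
  apply: (@step o1 o3 o0 o2 o4 true true false) => //.
  rewrite (C false o1 o3 _ o0 o2) (C true o1 o3 _ o0 o2)
    (C false o1 o3 _ o0 o4) (C true o1 o3 _ o0 o4).
  by rewrite /K5_parity; ring.
transitivity (K5_parity true true true true true true true false false false).
  apply: (@step o1 o4 o0 o2 o3 true true false) => //.
  rewrite (C false o1 o4 _ o0 o2) (C true o1 o4 _ o0 o2)
    (C false o1 o4 _ o0 o3) (C true o1 o4 _ o0 o3).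
  by rewrite /K5_parity; ring.
transitivity (K5_parity true true true true true true true true false false).
  apply: (@step o2 o3 o0 o1 o4 true true true) => //.
  rewrite (C false o2 o3 _ o0 o1) (C true o2 o3 _ o0 o1)
    (C false o2 o3 _ o0 o4) (C true o2 o3 _ o0 o4)
    (C false o2 o3 _ o1 o4) (C true o2 o3 _ o1 o4).
  by rewrite /K5_parity; ring.
transitivity (K5_parity true true true true true true true true true false).
  apply: (@step o2 o4 o0 o1 o3 true true true) => //.
  rewrite (C false o2 o4 _ o0 o1) (C true o2 o4 _ o0 o1)
    (C false o2 o4 _ o0 o3) (C true o2 o4 _ o0 o3)
    (C false o2 o4 _ o1 o3) (C true o2 o4 _ o1 o3).
  by rewrite /K5_parity; ring.
apply: (@step o3 o4 o0 o1 o2 true true true) => //.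
rewrite (C false o3 o4 _ o0 o1) (C true o3 o4 _ o0 o1)
  (C false o3 o4 _ o0 o2) (C true o3 o4 _ o0 o2)
  (C false o3 o4 _ o1 o2) (C true o3 o4 _ o1 o2).
by rewrite /K5_parity; ring.
Qed.

Lemma K5_crossing : exists i j k l : 'I_5, [/\ uniq [:: i; j; k; l], (i < j)%N,
  (k < l)%N & D false i j false k l].
Proof.
have := K5_parity_odd; rewrite /K5_parity.
case E0123 : (D false o0 o1 false o2 o3); first by move=> _; exists o0, o1, o2, o3.
case E0124 : (D false o0 o1 false o2 o4); first by move=> _; exists o0, o1, o2, o4.
case E0134 : (D false o0 o1 false o3 o4); first by move=> _; exists o0, o1, o3, o4.
case E0213 : (D false o0 o2 false o1 o3); first by move=> _; exists o0, o2, o1, o3.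
case E0214 : (D false o0 o2 false o1 o4); first by move=> _; exists o0, o2, o1, o4.
case E0234 : (D false o0 o2 false o3 o4); first by move=> _; exists o0, o2, o3, o4.
case E0312 : (D false o0 o3 false o1 o2); first by move=> _; exists o0, o3, o1, o2.
case E0314 : (D false o0 o3 false o1 o4); first by move=> _; exists o0, o3, o1, o4.
case E0324 : (D false o0 o3 false o2 o4); first by move=> _; exists o0, o3, o2, o4.
case E0412 : (D false o0 o4 false o1 o2); first by move=> _; exists o0, o4, o1, o2.
case E0413 : (D false o0 o4 false o1 o3); first by move=> _; exists o0, o4, o1, o3.
case E0423 : (D false o0 o4 false o2 o3); first by move=> _; exists o0, o4, o2, o3.
case E1234 : (D false o1 o2 false o3 o4); first by move=> _; exists o1, o2, o3, o4.
case E1324 : (D false o1 o3 false o2 o4); first by move=> _; exists o1, o3, o2, o4.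
case E1423 : (D false o1 o4 false o2 o3); first by move=> _; exists o1, o4, o2, o3.
by [].
Qed.
End PolygonalK5.

(** * Topological drawings of K5 *)

(** The distinct numbers d/(k+2) with k below [size p] lie strictly between 0 and [d], and they are
    too many to be all roots. *)
Lemma poly_nonroot_small (R : realFieldType) (p : {poly R}) (d : R) :
  p != 0 -> 0 < d -> exists t, [/\ 0 < t, t < d & p.[t] != 0].
Proof.
move=> p0 d0; apply: contrapT => H.
pose f (k : nat) : R := d / k.+2%:R.
have f_inj : injective f.
  move=> a b /(congr1 (fun x => d / x)); rewrite /f !invfM !invrK !mulrA divff ?gt_eqF //.
  by rewrite !mul1r => /eqP; rewrite eqr_nat => /eqP[].
suff : false by [].
have := @max_poly_roots _ p (map f (iota 0 (size p))) p0.
rewrite map_inj_uniq // iota_uniq size_map size_iota ltnn; apply=> //.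
apply/allP => _ /mapP[k _ ->]; apply/negPn/negP => fk; apply: H.
exists (f k); split=> //; first by rewrite divr_gt0.
by rewrite ltr_pdivrMr ?ltr0n // ltr_pMr // ltr1n.
Qed.

Lemma norm_pair_lt (R : realType) (p : R * R) (e : R) :
  (`|p| < e) = (`|p.1| < e) && (`|p.2| < e).
Proof. by rewrite prod_normE comparable_gt_max // real_comparable. Qed.

Lemma crosses_dist (R : realType) (p q r s : R * R) : crosses p q r s ->
  `|p - r| <= `|q - p| + `|s - r|.
Proof.
rewrite /crosses /ccw => /andP[h1 h2].
have d1 : det3 p q r - det3 p q s != 0.
  by apply: contraNneq h1 => /subr0_eq ->.
have d2 : det3 r s p - det3 r s q != 0.
  by apply: contraNneq h2 => /subr0_eq ->.
have ratio (a b : R) : (0 < a) != (0 < b) -> `|a / (a - b)| <= 1.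
  case: (ltrP 0 a) => ha; case: (ltrP 0 b) => hb // _.
    rewrite ger0_norm ?ler_pdivrMr; try lra.
    by apply: divr_ge0; lra.
  have -> : a / (a - b) = (- a) / (b - a) by rewrite -opprB invrN mulrN mulNr.
  rewrite ger0_norm ?ler_pdivrMr; try lra.
  by apply: divr_ge0; lra.
(* The fractions are the parameters of the intersection point on [rs] and on [pq]; [ratio] bounds
   both by 1. *)
have -> : p - r = det3 p q r / (det3 p q r - det3 p q s) *: (s - r)
                 - det3 r s p / (det3 r s p - det3 r s q) *: (q - p).
  move: d1 d2; rewrite /det3.
  case: p q r s {h1 h2} => [p1 p2] [q1 q2] [r1 r2] [s1 s2] /= d1 d2.
  by congr (_, _); rewrite /= -![_ *: _]/(_ * _); field; rewrite d1 d2.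
apply: le_trans (ler_normB _ _) _; rewrite addrC !normrZ.
by apply: lerD; apply: ler_piMl => //; rewrite -normrM; apply: ratio.
Qed.

(** Each point moves by [t] times its own point on the moment curve. The determinant of a triple is
    then a polynomial in [t] whose coefficient of t^2 is a Vandermonde product, hence nonzero, and a
    small [t] avoids the roots of all triples at once. *)
Lemma perturb_generic (R : realType) (X : finType) (Q : X -> R * R) (d : R) :
  0 < d -> exists Q' : X -> R * R, (forall x, `|Q' x - Q x| < d) /\
    forall a b c, uniq [:: a; b; c] -> det3 (Q' a) (Q' b) (Q' c) != 0.
Proof.
move=> d0; pose n (x : X) : R := (enum_rank x)%:R.
have n_inj : injective n.
  by move=> x y /eqP; rewrite eqr_nat => /eqP /val_inj /enum_rank_inj.
(* the moment curve: three of its points are never collinear *)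
pose V x : R * R := (n x, n x ^+ 2).
pose Qt t x := Q x + t *: V x.
pose B a b c := ((Q b).1 - (Q a).1) * ((V c).2 - (V a).2)
  + ((V b).1 - (V a).1) * ((Q c).2 - (Q a).2)
  - ((Q b).2 - (Q a).2) * ((V c).1 - (V a).1)
  - ((V b).2 - (V a).2) * ((Q c).1 - (Q a).1).
pose p a b c : {poly R} := (det3 (Q a) (Q b) (Q c))%:P + B a b c *: 'X
  + det3 (V a) (V b) (V c) *: 'X^2.
have pE a b c t : (p a b c).[t] = det3 (Qt t a) (Qt t b) (Qt t c).
  by rewrite /p !hornerE /Qt /B /det3 /= -![_ *: _]/(_ * _); ring.
have p0 a b c : uniq [:: a; b; c] -> p a b c != 0.
  rewrite /= !inE !negb_or => /and3P[/andP[ab ac] bc _].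
  apply/eqP => /(congr1 (fun q : {poly R} => q`_2)).
  rewrite /p !coefE /= mulr0 !add0r mulr1.
  have -> : det3 (V a) (V b) (V c) = (n b - n a) * (n c - n a) * (n c - n b).
    by rewrite /det3 /V /=; ring.
  move/eqP; rewrite !mulf_eq0 !subr_eq0 !(inj_eq n_inj).
  by rewrite eq_sym (negPf ab) eq_sym (negPf ac) eq_sym (negPf bc).
pose P := \prod_(u : X * X * X | uniq [:: u.1.1; u.1.2; u.2]) p u.1.1 u.1.2 u.2.
have P0 : P != 0 by apply/prodf_neq0 => u; apply: p0.
(* Both coordinates of [V x] stay below M^2, so t < d / M^2 moves every point by less than [d]. *)
pose M : R := #|X|%:R + 1.
have M0 : 0 < M ^+ 2 by rewrite exprn_gt0 // ltr_wpDl.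
have [t [t0 td Pt]] := poly_nonroot_small P0 (divr_gt0 d0 M0).
exists (Qt t); split=> [x|a b c u]; last first.
  move: Pt; rewrite /P horner_prod => /prodf_neq0 /(_ (a, b, c) u).
  by rewrite pE.
rewrite /Qt addrC addKr norm_pair_lt /= !normrM (gtr0_norm t0).
move: td; rewrite ltr_pdivlMr // => td.
have nM : n x < M by rewrite /M /n natr1 ltr_nat ltnS ltnW.
have n0 : 0 <= n x by rewrite /n.
have M1 : 1 <= M by rewrite /M lerDr.
rewrite !(ger0_norm n0) -expr2.
have lt1 : n x < M ^+ 2 by rewrite expr2; nra.
have lt2 : n x ^+ 2 < M ^+ 2 by rewrite !expr2; nra.
by apply/andP; split; apply: lt_trans td; rewrite ltr_pM2l.
Qed.

(** The points of [A] reachable from [u] by steps shorter than [e] form a nonempty, relatively open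
    and closed subset. *)
Lemma connected_chain (R : realType) (A : set (R * R)) (u v : R * R) (e : R) :
  connected A -> A u -> A v -> 0 < e ->
  exists l, path (fun x y => `|x - y| < e) u (rcons l v) /\
    {in rcons l v, forall x, A x}.
Proof.
move=> cA Au Av e0.
pose reach x := exists l, path (fun x y => `|x - y| < e) u (rcons l x) /\
  {in rcons l x, forall y, A y}.
suff : A `&` reach = A by move=> AE; move: Av; rewrite -{1}AE => -[_].
have ext x y : reach x -> A y -> `|x - y| < e -> reach y.
  move=> [l [pl Al]] Ay xy; exists (rcons l x); rewrite rcons_path pl last_rcons.
  split=> // z; rewrite mem_rcons inE => /orP[/eqP->//|]; exact: Al.
apply: cA.
- exists u; split=> //; exists [::]; rewrite /= subrr normr0 e0; split=> //.
  by move=> z; rewrite inE => /eqP->.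
- exists (\bigcup_(x in A `&` reach) ball x e).
    by apply: bigcup_open => x _; apply: ball_open.
  apply/seteqP; split=> [x [Ax rx]|x [Ax [y [Ay ry] yx]]]; split=> //.
    by exists x => //; apply: ballxx.
  by apply: ext ry Ax _; rewrite -ball_normE in yx.
- exists (~` \bigcup_(x in A `&` ~` reach) ball x e).
    by apply: open_closedC; apply: bigcup_open => x _; apply: ball_open.
  apply/seteqP; split=> [x [Ax rx]|x [Ax nx]]; split=> //.
    move=> [y [Ay nry] yx]; apply: nry; apply: ext rx Ay _.
    by rewrite distrC; rewrite -ball_normE in yx.
  by apply: contrapT => nrx; apply: nx; exists x => //; apply: ballxx.
Qed.

Lemma compact_disjoint_dist (R : realType) (A B : set (R * R)) :
  compact A -> compact B -> A `&` B = set0 ->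
  exists2 e : R, 0 < e & forall x y, A x -> B y -> e <= `|x - y|.
Proof.
move=> cA cB AB.
have [->|/set0P[a Aa]] := eqVneq A set0; first by exists 1.
have [->|/set0P[b Bb]] := eqVneq B set0; first by exists 1.
have [|||c cAB cmin] := @compact_EVT_min _ R (fun z => `|z.1 - z.2|) (A `*` B).
- by exists (a, b).
- exact: compact_setX.
- apply: continuous_subspaceT => z.
  by apply: cvg_norm; apply: cvgB; [exact: cvg_fst|exact: cvg_snd].
exists `|c.1 - c.2|; last first.
  by move=> x y Ax By; apply: (cmin (x, y)); rewrite inE.
rewrite normr_gt0 subr_eq0; apply/eqP => E.
move: cAB; rewrite inE => -[Ac Bc].
have : (A `&` B) c.1 by split=> //; rewrite E.
by rewrite AB.
Qed.

Lemma finite_common_bound (R : realType) (T : finType) (P : T -> R -> Prop) :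
  (forall t, exists2 e, 0 < e & forall e', e' <= e -> P t e') ->
  exists2 e, 0 < e & forall t, P t e.
Proof.
move=> H.
have [t|f f_spec] := @choice T R (fun t e => 0 < e /\ forall e', e' <= e -> P t e').
  by have [e e0 eP] := H t; exists e.
exists (\big[Order.min/1]_t f t).
  by apply: lt_bigmin => [|t _]; [exact: ltr01|exact: (f_spec t).1].
by move=> t; apply: (f_spec t).2; apply: bigmin_le.
Qed.

Lemma map_nth_enum_ord (T : Type) (x0 : T) (l : seq T) N : (size l <= N)%N ->
  [seq nth x0 l (k : 'I_N) | k <- take (size l) (enum 'I_N)] = l.
Proof.
move=> lN; rewrite (map_comp (nth x0 l) val) map_take val_enum_ord take_iota.
by rewrite (minn_idPl lN) map_nth_iota0 ?take_size.
Qed.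

(** Otherwise independent sets keep a distance of at least [e]. Fine chains along them, perturbed to
    general position, cross by [K5_crossing], and the crossing segments are too short to bridge that
    distance. *)
Theorem topological_K5 (R : realType) (P : 'I_5 -> R * R)
    (A : 'I_5 -> 'I_5 -> set (R * R)) :
  (forall i j : 'I_5, (i < j)%N ->
    [/\ compact (A i j), connected (A i j), A i j (P i) & A i j (P j)]) ->
  exists i j k l : 'I_5, [/\ uniq [:: i; j; k; l], (i < j)%N, (k < l)%N &
    A i j `&` A k l !=set0].
Proof.
move=> HA; apply: contrapT => no.
have [e e0 He] : exists2 e : R, 0 < e & forall u : 'I_5 * 'I_5 * 'I_5 * 'I_5,
    let: (i, j, k, l) := u in
    uniq [:: i; j; k; l] -> (i < j)%N -> (k < l)%N ->
    forall x y, A i j x -> A k l y -> e <= `|x - y|.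
  apply: finite_common_bound => -[[[i j] k] l].
  have [[u ij kl]|nu] := pselect [/\ uniq [:: i; j; k; l], (i < j)%N & (k < l)%N];
    last by exists 1 => // e' _ u ij kl; case: nu.
  have [cij _ _ _] := HA _ _ ij; have [ckl _ _ _] := HA _ _ kl.
  have [|e e0 He] := compact_disjoint_dist cij ckl.
    apply/seteqP; split=> // z Az; apply: no.
    by exists i, j, k, l; split=> //; exists z.
  exists e => // e' e'e _ _ _ x y Ax By; exact: le_trans e'e (He _ _ Ax By).
(* A chain step and the shifts of its two ends make a segment shorter than 3e/8. Two crossing
   segments and the shifts of [a] and [c] then give a distance below 6e/8 + 2e/8 = e. *)
have d0 : 0 < e / 8 by rewrite divr_gt0.
have [[i j]|L HL] := @choice ('I_5 * 'I_5)%type (seq (R * R)) (fun ij l =>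
    (ij.1 < ij.2)%N ->
    path (fun x y => `|x - y| < e / 8) (P ij.1) (rcons l (P ij.2)) /\
    {in rcons l (P ij.2), forall x, A ij.1 ij.2 x}).
  case: (ltnP i j) => /= ij; last by exists [::].
  have [_ cA Ai Aj] := HA _ _ ij.
  by have [l hl] := connected_chain cA Ai Aj d0; exists l.
(* One index range for all chains. Indices past the end of a chain get the default point 0, and the
   perturbation puts these in general position too. *)
pose N := (\max_ij size (L ij))%N.
pose Q0 (x : 'I_5 + ('I_5 * 'I_5) * 'I_N) : R * R :=
  match x with inl i => P i | inr (ij, k) => nth 0 (L ij) k end.
have [Q [QQ0 gen]] := perturb_generic Q0 d0.
have [i [j [k [l [u ij kl]]]]] := K5_crossing (fun i j => size (L (i, j))) gen.
move=> /crossing_parity_true[a [b [c [d [cr ab cd]]]]].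
have edge (i' j' : 'I_5) (a' b' : 'I_5 + ('I_5 * 'I_5) * 'I_N) : (i' < j')%N ->
    (exists l1 l2, inl i' :: poly_path N (fun i j => size (L (i, j))) false i' j'
       = l1 ++ a' :: b' :: l2) ->
    A i' j' (Q0 a') /\ `|Q b' - Q a'| < 3 * (e / 8).
  move=> ij' [l1 [l2 E]]; have [_ _ Ai Aj] := HA _ _ ij'.
  have [/= pL AL] := HL (i', j') ij'.
  have E' : P i' :: rcons (L (i', j')) (P j') = map Q0 (l1 ++ a' :: b' :: l2).
    rewrite -E /= map_rcons -map_comp; congr (_ :: rcons _ _).
    have szN : (size (L (i', j')) <= N)%N.
      exact: (@leq_bigmax _ (fun ij => size (L ij)) (i', j')).
    by rewrite -[LHS](map_nth_enum_ord 0 szN).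
  split.
    have : Q0 a' \in P i' :: rcons (L (i', j')) (P j').
      by rewrite E' map_f // mem_cat mem_head orbT.
    by rewrite inE => /orP[/eqP->//|/AL].
  have : sorted (fun x y => `|x - y| < e / 8) (P i' :: rcons (L (i', j')) (P j')) by [].
  rewrite E' map_cat => /cat_sorted2[_] /= /andP[ab' _].
  have -> : Q b' - Q a' = (Q b' - Q0 b') - (Q a' - Q0 a') - (Q0 a' - Q0 b').
    by rewrite !opprB addrA; ring.
  apply: le_lt_trans (ler_normB _ _) _.
  have := ler_normB (Q b' - Q0 b') (Q a' - Q0 a').
  have := QQ0 a'; have := QQ0 b'; lra.
have [Aa Qab] := edge _ _ _ _ ij ab; have [Ac Qcd] := edge _ _ _ _ kl cd.
have := He (i, j, k, l) u ij kl _ _ Aa Ac.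
have := crosses_dist cr.
have := QQ0 a; have := QQ0 c.
have -> : Q0 a - Q0 c = (Q a - Q c) - (Q a - Q0 a) + (Q c - Q0 c).
  by rewrite !opprB; ring.
have := ler_normD ((Q a - Q c) - (Q a - Q0 a)) (Q c - Q0 c).
have := ler_normB (Q a - Q c) (Q a - Q0 a).
lra.
Qed.

(** * Regions bounded by closed curves *)

Section Joined.
Variable R : realType.
Local Notation plane := (R * R)%type.
Implicit Types (U K C : set plane) (x y z p q : plane) (g h : R -> plane).

Definition segment x y : set plane := [set x + t *: (y - x) | t in `[0, 1]].

Lemma segmentl x y : segment x y x.
Proof. by exists 0; rewrite ?scale0r ?addr0 //= in_itv /= lexx ler01. Qed.

Lemma segmentr x y : segment x y y.
Proof.
exists 1; first by rewrite /= in_itv /= lexx ler01.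
by rewrite scale1r addrC subrK.
Qed.

Lemma segment_continuous x y : continuous (fun t : R => x + t *: (y - x)).
Proof.
move=> t; apply: cvgD; first exact: cvg_cst.
by apply: cvgZr_tmp; exact: cvg_id.
Qed.

Lemma compact_segment x y : compact (segment x y).
Proof.
apply: continuous_compact (segment_compact (a := 0) (b := 1)).
exact/continuous_subspaceT/segment_continuous.
Qed.

Lemma connected_segment x y : connected (segment x y).
Proof.
apply: connected_continuous_connected; first exact: segment_connected.
exact/continuous_subspaceT/segment_continuous.
Qed.

(** Compactness is built in because [topological_K5] takes compact connected sets as edges. *)
Definition joined U x y := exists K : set plane,
  [/\ compact K, connected K, K `<=` U, K x & K y].

Lemma joined_sym U x y : joined U x y -> joined U y x.
Proof. by move=> [K [*]]; exists K. Qed.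

Lemma joined_trans U y x z : joined U x y -> joined U y z -> joined U x z.
Proof.
move=> [K [cK nK KU Kx Ky]] [L [cL nL LU Ly Lz]]; exists (K `|` L); split.
- exact: compactU.
- by apply: connectedU => //; exists y.
- by rewrite subUset.
- by left.
- by right.
Qed.

Lemma joined_segment U x y : segment x y `<=` U -> joined U x y.
Proof.
move=> sU; exists (segment x y); split=> //.
- exact: compact_segment.
- exact: connected_segment.
- exact: segmentl.
- exact: segmentr.
Qed.

Lemma segment_ball x y (e : R) : ball x e y -> segment x y `<=` ball x e.
Proof.
rewrite -ball_normE /= => xy _ [t /= /[!in_itv] /= /andP[t0 t1] <-].
rewrite /= opprD addrA subrr add0r normrN normrZ ger0_norm //.
apply: le_lt_trans xy; rewrite distrC; exact: ler_piMl.
Qed.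

(** Balls contain the segments from their centre, so being joined to [x] inside the open set [U] is
    both an open and a closed condition on [C]. *)
Lemma joined_connected U C x y : open U -> connected C -> C `<=` U ->
  C x -> C y -> joined U x y.
Proof.
move=> oU cC CU Cx Cy.
have near z w : joined U x z -> forall e, ball z e `<=` U -> ball z e w -> joined U x w.
  move=> jz e zU zw; apply: joined_trans jz _; apply: joined_segment.
  exact: subset_trans (segment_ball zw) zU.
have near' z w : joined U x w -> forall e, ball z e `<=` U -> ball z e w -> joined U x z.
  move=> jz e zU zw; apply: joined_trans jz _; apply: joined_sym; apply: joined_segment.
  exact: subset_trans (segment_ball zw) zU.
have Ub z : C z -> exists2 e : R, 0 < e & ball z e `<=` U.
  move=> /CU Uz; have /nbhs_ballP[e e0 zU] := open_nbhs_nbhs (conj oU Uz).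
  by exists e.
suff : C `&` joined U x = C by move=> CE; move: Cy; rewrite -{1}CE => -[].
apply: cC.
- exists x; split=> //; have [e e0 xU] := Ub _ Cx.
  apply: joined_segment => _ [t _ <-]; rewrite subrr scaler0 addr0.
  exact/xU/ballxx.
- exists (\bigcup_(w in [set w : plane * R |
      joined U x w.1 /\ ball w.1 w.2 `<=` U]) ball w.1 w.2).
    by apply: bigcup_open => w _; apply: ball_open.
  apply/seteqP; split=> [z [Cz jz]|z [Cz [w [jw wU] wz]]]; split=> //; last first.
    exact: near jw _ wU wz.
  by have [e e0 zU] := Ub _ Cz; exists (z, e) => //; apply: ballxx.
- exists (~` \bigcup_(w in [set w : plane * R |
      ~ joined U x w.1 /\ ball w.1 w.2 `<=` U]) ball w.1 w.2).
    by apply: open_closedC; apply: bigcup_open => w _; apply: ball_open.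
  apply/seteqP; split=> [z [Cz jz]|z [Cz nz]]; split=> //.
    by move=> [w [jw wU] wz]; apply: jw; exact: near' jz _ wU wz.
  have [e e0 zU] := Ub _ Cz.
  by apply: contrapT => njz; apply: nz; exists (z, e) => //; apply: ballxx.
Qed.

(** The norm is the maximum norm, so the set is a union of four half-planes. Every point reaches the
    corner [c] by at most two segments, each within one half-plane. *)
Lemma far_joined (M : R) x y : 0 <= M -> M < `|x| -> M < `|y| ->
  joined [set z | M < `|z|] x y.
Proof.
move=> M0; pose c : plane := (M + 1, M + 1).
have norm_gt (z : plane) : (M < `|z|) = (M < `|z.1|) || (M < `|z.2|).
  by rewrite prod_normE lt_max.
have conv (a b t : R) : M < a -> M < b -> 0 <= t -> t <= 1 -> M < a + t * (b - a).
  move=> Ma Mb t0 t1; case: (lerP a b) => ab.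
    by rewrite (lt_le_trans Ma) // lerDl mulr_ge0 // subr_ge0.
  apply: (lt_le_trans Mb); rewrite -subr_ge0.
  have -> : a + t * (b - a) - b = (1 - t) * (a - b) by ring.
  by rewrite mulr_ge0 // subr_ge0 // ltW.
have seg1 (p q : plane) : (M < p.1 /\ M < q.1) \/ (p.1 < - M /\ q.1 < - M) \/
    (M < p.2 /\ M < q.2) \/ (p.2 < - M /\ q.2 < - M) ->
    joined [set z | M < `|z|] p q.
  move=> H; apply: joined_segment => _ [t /= /[!in_itv] /= /andP[t0 t1] <-].
  rewrite norm_gt /= -![_ *: _]/(_ * _) !lter_normr.
  case: H => [[h1 h2]|[[h1 h2]|[[h1 h2]|[h1 h2]]]].
  - by rewrite conv.
  - have -> : M < - (p.1 + t * (q.1 - p.1)); last by rewrite orbT.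
    by have := conv (- p.1) (- q.1) t; lra.
  - by rewrite (conv p.2) ?orbT.
  - have -> : M < - (p.2 + t * (q.2 - p.2)); last by rewrite !orbT.
    by have := conv (- p.2) (- q.2) t; lra.
suff H z : M < `|z| -> joined [set z | M < `|z|] z c.
  by move=> /H jx /H jy; apply: joined_trans jx (joined_sym jy).
rewrite norm_gt !lter_normr => /orP[/orP[]|/orP[]] hz.
- by apply: seg1; left; rewrite /=; split; lra.
- apply: (@joined_trans _ (- M - 1, M + 1)); apply: seg1; right.
    by left; rewrite /=; split; lra.
  by right; left; rewrite /=; split; lra.
- by apply: seg1; right; right; left; rewrite /=; split; lra.
- apply: (@joined_trans _ (M + 1, - M - 1)); apply: seg1.
    by right; right; right; rewrite /=; split; lra.
  by left; rewrite /=; split; lra.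
Qed.

(** Both points lie in unbounded components of the complement of the curve, hence can be joined to
    points beyond a square containing the curve, and these to each other. *)
Lemma outside_joined g p q : {within `[0, 1], continuous g} ->
  ~ closed_region g p -> ~ closed_region g q ->
  exists K : set plane, [/\ compact K, connected K, K p, K q &
    K `&` closed_region g = set0].
Proof.
move=> cg np nq; pose T := closed_trace g.
have cT : compact T by apply: continuous_compact => //; exact: segment_compact.
have oT : open (~` T).
  by apply: closed_openC; apply: compact_closed => //; exact: norm_hausdorff.
have [M [M0 TM]] : exists M : R, 0 <= M /\ forall z, T z -> `|z| <= M.
  have [M [Mr HM]] := compact_bounded cT.
  exists (`|M| + 1); split; first by rewrite addr_ge0.
  by move=> z Tz; apply: HM Tz; rewrite (le_lt_trans (ler_norm M)) // ltrDl.
have far z : ~ closed_region g z ->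
    exists2 z', joined (~` T) z z' & M < `|z'|.
  move=> nz; have nTz : ~ T z by move=> Tz; apply: nz; left.
  have nb : ~ bounded_set (connected_component (~` T) z).
    by move=> b; apply: nz; right.
  have [z' Cz' Mz'] : exists2 z', connected_component (~` T) z z' & M < `|z'|.
    apply: contrapT => H; apply: nb; exists M; split; first exact: ger0_real.
    move=> M' MM' z' Cz'; apply: le_trans (ltW MM'); rewrite leNgt.
    by apply/negP => ?; apply: H; exists z'.
  exists z' => //; apply: (joined_connected oT _ _ _ Cz').
  - exact: component_connected.
  - exact: connected_component_sub.
  - exact: connected_component_refl.
have [p' jp Mp] := far _ np; have [q' jq Mq] := far _ nq.
have jpq : joined (~` T) p' q'.
  have [K [cK nK KM Kp Kq]] := far_joined M0 Mp Mq.
  exists K; split=> // z /KM /= Mz /TM; by rewrite leNgt Mz.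
have [K [cK nK KT Kp Kq]] := joined_trans (joined_trans jp jpq) (joined_sym jq).
exists K; split=> //; apply/seteqP; split=> // z [Kz [/(KT _ Kz)//|[nTz bz]]].
(* [K] lies in a single component, so a point of [K] inside the curve would put [p] inside as
   well. *)
apply: np; right; split; first exact: KT.
suff -> : connected_component (~` closed_trace g) p =
  connected_component (~` closed_trace g) z by [].
by apply: same_connected_component; apply: (connected_component_max Kp KT nK).
Qed.

Lemma subarc_inside g h (a b t s : R) : {within `[0, 1], continuous h} ->
  0 <= a -> b <= 1 -> a <= t <= b -> a <= s <= b ->
  (forall r, a <= r <= b -> ~ closed_trace g (h r)) ->
  inside g (h s) -> inside g (h t).
Proof.
move=> ch a0 b1 tab sab avoid [_ bs].
pose K := h @` `[a, b].
have nK : connected K.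
  apply: connected_continuous_connected; first exact: segment_connected.
  apply: continuous_subspaceW ch => r /=; rewrite !in_itv /= => /andP[ar rb].
  by rewrite (le_trans a0 ar) (le_trans rb b1).
have KU : K `<=` ~` closed_trace g.
  by move=> _ [r /= /[!in_itv] /= rab <-]; apply: avoid.
have Kt : K (h t) by exists t; rewrite //= in_itv.
have Ks : K (h s) by exists s; rewrite //= in_itv.
split; first exact: avoid.
suff -> : connected_component (~` closed_trace g) (h t) =
  connected_component (~` closed_trace g) (h s) by [].
by apply: same_connected_component; apply: (connected_component_max Kt KU nK).
Qed.

Lemma arc_in_region g h : simple_arc h ->
  inside g (h 0) -> inside g (h 1) ->
  (forall p q, (open_trace h `&` closed_trace g) p ->
     (open_trace h `&` closed_trace g) q -> p = q) ->
  closed_trace h `<=` closed_region g.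
Proof.
move=> [ch ih] i0 i1 one _ [t tI <-].
have [t0 t1] : 0 <= t /\ t <= 1 by move: tI; rewrite /= in_itv /= => /andP.
have [gt|ngt] := pselect (closed_trace g (h t)); first by left.
right.
have [[r rt gr]|nl] := pselect (exists2 r, 0 <= r <= t & closed_trace g (h r)); last first.
  apply: (@subarc_inside g h 0 t t 0) => //; rewrite ?lexx ?t0 // => r rt gr.
  by apply: nl; exists r.
apply: (@subarc_inside g h t 1 t 1) => //; rewrite ?lexx ?t1 // => s /andP[ts s1] gs.
case/andP: rt => r0 rt.
have op u : 0 <= u <= 1 -> closed_trace g (h u) -> (open_trace h `&` closed_trace g) (h u).
  move=> /andP[u0 u1] gu; split=> //; exists u => //=.
  rewrite in_itv /= !lt_neqAle u0 u1 !andbT.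
  apply/andP; split; apply/eqP => E; move: gu.
    by rewrite -E; case: i0.
  by rewrite E; case: i1.
have := one _ _ (op r _ gr) (op s _ gs).
rewrite r0 s1 (le_trans rt t1) (le_trans t0 ts) => /(_ isT isT) /ih.
rewrite !in_itv /= r0 s1 (le_trans rt t1) (le_trans t0 ts) => /(_ isT isT) E.
have tr : t = r by apply/eqP; rewrite eq_le rt andbT E.
by apply: ngt; rewrite tr.
Qed.
End Joined.

(** * The clustered graph *)

Section ThickK5.
Variable p : nat.

(** The order matters: positions 6, 7 and 8 hold the edges among [o2], [o3], [o4], which
    [in_cluster] recognises by [6 <= e]. *)
Definition K5_edges : seq ('I_5 * 'I_5) :=
  [:: (o0, o2); (o0, o3); (o0, o4); (o1, o2); (o1, o3); (o1, o4);
    (o2, o3); (o2, o4); (o3, o4)].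

Definition ends (e : 'I_9) : 'I_5 * 'I_5 := nth (o0, o0) K5_edges e.

Definition incident (k : 'I_5) (e : 'I_9) : bool :=
  (k == (ends e).1) || (k == (ends e).2).

(** [inl] gives the hubs, [inr (e, i)] the middle vertex of the [i]-th path for the edge [e]. Paths
    are numbered by ['F_p] so that they can be chosen along lines. *)
Definition thick_vertex := ('I_5 + 'I_9 * 'F_p)%type.

Definition thick_adj (x y : thick_vertex) : bool :=
  match x, y with
  | inl k, inr (e, _) => incident k e
  | inr (e, _), inl k => incident k e
  | _, _ => false
  end.

Lemma thick_adj_sym : symmetric thick_adj.
Proof. by move=> [k|[e i]] [l|[f j]]. Qed.

Lemma thick_adj_irr : irreflexive thick_adj.
Proof. by move=> [k|[e i]]. Qed.

Definition thick_graph := SGraph thick_adj_sym thick_adj_irr.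

Definition in_cluster (v : thick_vertex) : bool :=
  match v with inl k => (2 <= k)%N | inr (e, _) => (6 <= e)%N end.

(** [None] is the root, [Some None] the inner cluster, and [Some (Some v)] the leaf of [v]. *)
Definition thick_node := option (option thick_vertex).

Definition thick_parent (x : thick_node) : thick_node :=
  if x is Some (Some v) then (if in_cluster v then Some None else None)
  else None.

Lemma iter_thick_parent_None n : iter n thick_parent None = None.
Proof. by elim: n => //= n ->. Qed.

Lemma thick_reach (x : thick_node) : fconnect thick_parent x None.
Proof.
have -> : None = iter 2 thick_parent x; last exact: fconnect_iter.
by case: x => [[v|]|] //=; case: in_cluster.
Qed.

Definition thick_tree := @RTree thick_node None thick_parent erefl thick_reach.

Lemma thick_leafE (x : thick_tree) :
  is_leaf x = (x \in codom (fun v : thick_vertex => Some (Some v))).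
Proof.
case: x => [[v|]|] /=.
- rewrite codom_f; apply/forallP => -[[w|]|] //=.
  by case: in_cluster.
- rewrite (_ : (_ \in _) = false); last by apply/negP => /codomP[].
  apply/negbTE/forallPn; exists (Some (Some (inl o4))).
  by rewrite negb_imply.
- rewrite (_ : (_ \in _) = false); last by apply/negP => /codomP[].
  apply/negbTE/forallPn; exists (Some (Some (inl o0))).
  by rewrite negb_imply.
Qed.

Lemma thick_leaf_inj : injective (fun v : thick_vertex => Some (Some v)).
Proof. by move=> v w []. Qed.

Definition thick_clustered : clustered_graph :=
  @ClusteredGraph thick_graph thick_tree _ thick_leaf_inj thick_leafE.

Definition core : ctree thick_clustered := (Some None : thick_node).

Lemma core_cluster : is_cluster core.
Proof. by rewrite /is_cluster thick_leafE; apply/negP => /codomP[]. Qed.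

Lemma thick_clusterP (nu : ctree thick_clustered) : is_cluster nu ->
  nu = (None : thick_node) \/ nu = core.
Proof.
rewrite /is_cluster thick_leafE; case: nu => [[v|]|] /=; [|by right|by left].
by rewrite codom_f.
Qed.

Lemma thick_ancestorP (x y : thick_tree) :
  reflect (exists n, x = iter n thick_parent y) (ancestor x y).
Proof.
apply: (iffP idP) => [h|[n ->]]; last exact: fconnect_iter.
by exists (findex thick_parent y x); rewrite iter_findex.
Qed.

Lemma mem_core (v : thick_clustered) : (v \in cluster_vertices core) = in_cluster v.
Proof.
rewrite inE; apply/thick_ancestorP/idP => [[[//|n]]|vin]; last by exists 1%N; rewrite /= vin.
by rewrite iterSr /=; case: in_cluster => //; rewrite iter_thick_parent_None.
Qed.

Lemma mem_root_cluster (v : thick_clustered) :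
  v \in cluster_vertices ((None : thick_node) : ctree thick_clustered).
Proof. by rewrite inE; apply: thick_reach. Qed.

Lemma thick_flat : flat thick_clustered.
Proof.
move=> x y /thick_clusterP[->|->] /thick_clusterP[->|->] //= _ /thick_ancestorP[n].
by rewrite iter_thick_parent_None.
Qed.

(** An edge incident to both the hub and [o4]; for the hubs of the inner cluster its position is at
    least 6, so its middle vertices belong to the cluster. *)
Definition hub_edge (k : 'I_5) : 'I_9 :=
  nth ord0 [:: @Ordinal 9 2 isT; @Ordinal 9 5 isT; @Ordinal 9 7 isT;
    @Ordinal 9 8 isT; @Ordinal 9 8 isT] k.

(** Within either cluster a middle vertex reaches the first end of its edge, and a hub reaches [o4]
    through a middle vertex of its [hub_edge]. *)
Lemma thick_c_connected : c_connected thick_clustered.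
Proof.
suff H (S : {set thick_graph}) : inl o4 \in S ->
    (forall k, inl k \in S -> inr (hub_edge k, 0) \in S) ->
    (forall e i, inr (e, i) \in S -> inl (ends e).1 \in S) ->
    induced_connected S.
  move=> nu /thick_clusterP[->|->]; apply: H.
  - exact: mem_root_cluster.
  - by move=> k _; apply: mem_root_cluster.
  - by move=> e i _; apply: mem_root_cluster.
  - by rewrite mem_core.
  - by move=> k; rewrite !mem_core /=; case: k => [[|[|[|[|[|k]]]]] kP].
  - by move=> e i; rewrite !mem_core /=; case: e => [[|[|[|[|[|[|[|[|[|e]]]]]]]]] eP].
move=> S4 Sk Se; pose r := [rel x y : thick_graph | [&& x \in S, y \in S & adj x y]].
have r_sym : connect_sym r.
  by apply: sym_connect_sym => x y /=; rewrite thick_adj_sym andbCA.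
have hub k : inl k \in S -> connect r (inl k) (inl o4).
  move=> kS; apply: (@connect_trans _ _ (inr (hub_edge k, 0))); apply: connect1.
    rewrite /= kS Sk //= /incident.
    by case: k {kS} => [[|[|[|[|[|k]]]]] kP].
  rewrite /= S4 Sk //= /incident.
  by case: k {kS} => [[|[|[|[|[|k]]]]] kP].
have all4 x : x \in S -> connect r x (inl o4).
  case: x => [k|[e i]] xS; first exact: hub.
  apply: (@connect_trans _ _ (inl (ends e).1)); last exact/hub/Se/xS.
  by apply: connect1; rewrite /= xS (Se _ _ xS) /= /incident eqxx.
move=> x y xS yS; rewrite -/r; apply: connect_trans (all4 x xS) _.
by rewrite r_sym; apply: all4.
Qed.

Lemma card_thick : prime p -> #|thick_clustered| = (5 + 9 * p)%N.
Proof. by move=> pp; rewrite card_sum card_prod (card_Fp pp) !card_ord. Qed.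

Definition thick_edge k e (i : 'F_p) : {set thick_vertex} := [set inl k; inr (e, i)]%SET.

Lemma thick_edge_in k e i : incident k e -> thick_edge k e i \in edges thick_graph.
Proof. by move=> ke; apply/imsetP; exists (inl k, inr (e, i)); rewrite ?inE. Qed.

Lemma edge_thick E : E \in edges thick_graph ->
  exists k e i, incident k e /\ E = thick_edge k e i.
Proof.
move=> /imsetP[[[k|[e i]] [l|[f j]]]]; rewrite inE //= => ke ->.
  by exists k, f, j.
by exists l, e, i; rewrite /thick_edge finset.setUC.
Qed.

Lemma thick_edge_inj k e i k' e' i' :
  thick_edge k e i = thick_edge k' e' i' -> [/\ k = k', e = e' & i = i'].
Proof.
move=> E; have : inl k \in thick_edge k' e' i' by rewrite -E !inE eqxx.
have : inr (e, i) \in thick_edge k' e' i' by rewrite -E !inE eqxx orbT.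
by rewrite !inE /= orbF => /eqP[-> ->] /eqP[->].
Qed.

Lemma ends_pick (i j : 'I_5) : (i < j)%N ->
  (exists e, ends e = (i, j)) \/ (i, j) = (o0, o1).
Proof.
move=> ij; have [T|T] : ((i, j) \in K5_edges) \/ ((i, j) == (o0, o1)).
- apply/orP; move: ij.
  by case: i => [[|[|[|[|[|i]]]]] iP]; case: j => [[|[|[|[|[|j]]]]] jP].
- left; exists (inord (index (i, j) K5_edges)).
  by rewrite /ends inordK ?nth_index //; move: T; rewrite -index_mem.
- by right; apply/eqP.
Qed.
End ThickK5.

(** * Counting crossings *)

Lemma card_II_le1 (T : Type) (A : set T) k : A #= `I_k -> (k <= 1)%N ->
  forall x y, A x -> A y -> x = y.
Proof.
move=> /card_set_bijP[f [fA fi _]] k1 x y Ax Ay.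
apply: fi; rewrite ?inE //.
have := fA _ Ax; have := fA _ Ay.
by rewrite /=; case: k k1 {fA} => [|[|k]] // _; rewrite !ltnS !leqn0 => /eqP-> /eqP->.
Qed.

Lemma finite_inj_card (T : finType) (U : Type) (A : set U) (f : T -> U) a :
  A #= `I_a -> injective f -> (forall t, A (f t)) -> (#|T| <= a)%N.
Proof.
move=> /card_set_bijP[g [gA gi _]] fi fA.
have ga t : (g (f t) < a)%N by exact: gA.
rewrite -[leqRHS]card_ord; apply: (@leq_card _ _ (fun t => Ordinal (ga t))).
move=> s t [] /gi; rewrite !inE => /(_ (fA s) (fA t)); exact: fi.
Qed.

Section GraphDrawings.
Variables (R : realType) (G : sgraph) (d : graph_drawing R G).
Local Notation plane := (R * R)%type.

Lemma closed_traceE (g : R -> plane) z : closed_trace g z ->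
  [\/ open_trace g z, z = g 0 | z = g 1].
Proof.
move=> [t /= /[!in_itv] /= /andP[t0 t1] <-].
have [->|tn0] := eqVneq t 0; first by constructor 2.
have [->|tn1] := eqVneq t 1; first by constructor 3.
constructor 1; exists t => //=.
by rewrite in_itv /= !lt_neqAle eq_sym tn0 tn1 t0 t1.
Qed.

Lemma arc_trace_compact e : e \in edges G -> compact (closed_trace (arc d e)).
Proof.
by move=> /(arc_simple d)[c _]; apply: continuous_compact => //; exact: segment_compact.
Qed.

Lemma arc_trace_connected e : e \in edges G -> connected (closed_trace (arc d e)).
Proof.
move=> /(arc_simple d)[c _]; apply: connected_continuous_connected => //.
exact: segment_connected.
Qed.

Lemma closed_trace0 (g : R -> plane) : closed_trace g (g 0).
Proof. by exists 0 => //=; rewrite in_itv /= lexx ler01. Qed.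

Lemma closed_trace1 (g : R -> plane) : closed_trace g (g 1).
Proof. by exists 1 => //=; rewrite in_itv /= lexx ler01. Qed.

Lemma arc_trace_end e v : e \in edges G -> v \in e -> closed_trace (arc d e) (pos d v).
Proof.
move=> eG; have [u [w [E E0 E1]]] := arc_ends d eG.
rewrite {1}E !inE => /orP[] /eqP->.
  by rewrite -E0; apply: closed_trace0.
by rewrite -E1; apply: closed_trace1.
Qed.

Lemma arc_traceE e z : e \in edges G -> closed_trace (arc d e) z ->
  open_trace (arc d e) z \/ exists2 v, v \in e & z = pos d v.
Proof.
move=> eG; have [u [w [E E0 E1]]] := arc_ends d eG.
case/closed_traceE => [|->|->]; first by left.
- by right; exists u => //; rewrite E !inE eqxx.
- by right; exists w => //; rewrite E !inE eqxx orbT.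
Qed.

(** A common point is not a vertex: positions are distinct, [e] and [f] share no vertex, and open
    arcs avoid all vertices. *)
Lemma arcs_meet_open e f z : e \in edges G -> f \in edges G ->
  (forall v, v \in e -> v \notin f) ->
  closed_trace (arc d e) z -> closed_trace (arc d f) z ->
  open_trace (arc d e) z /\ open_trace (arc d f) z.
Proof.
move=> eG fG ef /(arc_traceE eG)[oe|[v ve zv]] /(arc_traceE fG)[of'|[w wf zw]] //.
- by exfalso; move: oe; rewrite zw; apply: arc_avoids.
- by exfalso; move: of'; rewrite zv; apply: arc_avoids.
- by move: wf; rewrite -(pos_inj (etrans (esym zv) zw)) (negPf (ef _ ve)).
Qed.
End GraphDrawings.

(** * Quadratically many crossings in one drawing *)

Section LowerBound.
Variables (R : realType) (p : nat).
Hypothesis pp : prime p.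
Hypothesis p9 : (9 <= p)%N.
Variable d : drawing R (thick_clustered p).
Variable a : nat.
Hypothesis da : drawing_a00 d a.
Local Notation plane := (R * R)%type.
Local Notation "'tr' k e i" := (closed_trace (arc d (thick_edge k e i)))
  (at level 10, k, e, i at level 8).

Let inside_core v : in_cluster v -> inside (bd d (core p)) (pos d v).
Proof.
move=> vin; have /(region_vertices d (core_cluster p)) :
  v \in cluster_vertices (core p) by rewrite mem_core.
by case=> // /(bd_avoids (core_cluster p)).
Qed.

Let outside_core v : ~~ in_cluster v -> ~ closed_region (bd d (core p)) (pos d v).
Proof.
by move=> vin /(region_vertices d (core_cluster p)); rewrite mem_core (negPf vin).
Qed.

Lemma cluster_edge_in_region k e i : incident k e -> (2 <= k)%N -> (6 <= e)%N ->
  tr k e i `<=` closed_region (bd d (core p)).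
Proof.
move=> ke k2 e6; have eG := thick_edge_in i ke.
have [u [v [E E0 E1]]] := arc_ends d eG.
have inE' w : w \in thick_edge k e i -> in_cluster w.
  by rewrite !inE => /orP[] /eqP->.
apply: arc_in_region; first exact: arc_simple.
- by rewrite E0; apply/inside_core/inE'; rewrite E !inE eqxx.
- by rewrite E1; apply/inside_core/inE'; rewrite E !inE eqxx orbT.
(* Zero edge-region crossings means [n./2 = 0], which leaves at most one boundary point on the
   edge. *)
- have [_ /(_ _ _ eG (core_cluster p))[n [cn n0]] _] := da.
  by apply: (card_II_le1 cn); case: n n0 {cn} => [|[|n]].
Qed.

(* The choice i |-> x + e * y: two values of such a line determine (x, y). *)
Lemma line_crossing (x y : 'F_p) : let phi (e : 'I_9) := x + e%:R * y in
  exists z : plane, exists k l e f, [/\ incident k e, incident l f, e != f,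
    open_trace (arc d (thick_edge k e (phi e))) z &
    open_trace (arc d (thick_edge l f (phi f))) z].
Proof.
move=> phi.
have bdc : {within `[0, 1], continuous (bd d (core p))}.
  by have [] := bd_simple d (core_cluster p).
have [K [cK nK K0 K1 KR]] := outside_joined bdc
  (@outside_core (inl o0) isT) (@outside_core (inl o1) isT).
(* The selected path of length two stands for each edge of K5 except [o0 o1], which is represented
   by [K]. *)
pose A (i j : 'I_5) : set plane :=
  if [pick e | ends e == (i, j)] is Some e then tr i e (phi e) `|` tr j e (phi e)
  else K.
have AE (i j : 'I_5) : (i < j)%N ->
    (exists2 e, ends e = (i, j) & A i j = tr i e (phi e) `|` tr j e (phi e)) \/
    (i, j) = (o0, o1) /\ A i j = K.
  move=> ij; rewrite /A; case: pickP => [e /eqP ee|ne]; first by left; exists e.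
  right; split=> //; case: (ends_pick ij) => // -[e /eqP]; by rewrite ne.
have inc e i j : ends e = (i, j) -> incident i e /\ incident j e.
  by move=> ee; rewrite /incident ee /= !eqxx orbT.
have [i j ij|i [j [k [l [u ij kl [z [Aij Akl]]]]]]] :=
    @topological_K5 R (fun k => pos d (inl k)) A.
  case: (AE i j ij) => [[e ee ->]|[[-> ->] ->]] //.
  have [ie je] := inc _ _ _ ee.
  have mi := thick_edge_in (phi e) ie; have mj := thick_edge_in (phi e) je.
  split.
  - by apply: compactU; apply: arc_trace_compact.
  - apply: connectedU; try exact: arc_trace_connected.
    by exists (pos d (inr (e, phi e))); split;
      apply: arc_trace_end => //; rewrite !inE eqxx orbT.
  - by left; apply: arc_trace_end; rewrite ?inE ?eqxx.
  - by right; apply: arc_trace_end; rewrite ?inE ?eqxx.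
(* Edges independent of [o0 o1] join hubs of the inner cluster, so their paths stay in its region,
   which [K] misses. *)
have noK i' j' : uniq [:: o0; o1; i'; j'] -> (i' < j')%N -> A i' j' z -> K z -> False.
  move=> u' ij' Az Kz.
  suff : (K `&` closed_region (bd d (core p))) z by rewrite KR.
  split=> //; move: Az.
  case: (AE i' j' ij') => [[e ee ->]|[[E1 E2] _]]; last by move: u'; rewrite E1.
  have [ie je] := inc _ _ _ ee.
  have [i2 j2 e6] : [/\ (2 <= i')%N, (2 <= j')%N & (6 <= e)%N].
    move: u' ee {Kz}; rewrite /ends.
    case: e ie je => [[|[|[|[|[|[|[|[|[|e]]]]]]]]] eP] _ _ //= u' [E1 E2];
      by move: u'; rewrite -?E1 -?E2.
  by case; apply: cluster_edge_in_region.
case: (AE i j ij) (AE k l kl) => [[e ee Ae]|[[E1 E2] Ae]] [[f ff Af]|[[F1 F2] Af]].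
- move: Aij Akl; rewrite Ae Af => Aij Akl.
  have [ie je] := inc _ _ _ ee; have [kf lf] := inc _ _ _ ff.
  have ef : e != f.
    apply/eqP => E; move: ee; rewrite E ff => -[E1 E2].
    by move: u; rewrite E1 /= !inE eqxx /= orbT.
  have [i' [i'e i'ij tri]] : exists i',
      [/\ incident i' e, i' \in [:: i; j] & (tr i' e (phi e)) z].
    by case: Aij => h; [exists i|exists j]; rewrite !inE eqxx ?orbT.
  have [k' [k'f k'kl trk]] : exists k',
      [/\ incident k' f, k' \in [:: k; l] & (tr k' f (phi f)) z].
    by case: Akl => h; [exists k|exists l]; rewrite !inE eqxx ?orbT.
  exists z, i', k', e, f.
  have ik : i' != k'.
    move: i'ij k'kl u; rewrite /= !inE !negb_or.
    move=> /orP[] /eqP-> /orP[] /eqP-> /and4P[/and3P[? ? ?] /andP[? ?] _ _] //.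
  have [] := @arcs_meet_open R _ d _ _ z
    (thick_edge_in (phi e) i'e) (thick_edge_in (phi f) k'f).
  - by move=> w; rewrite !inE => /orP[] /eqP-> /=; rewrite ?orbF ?(inj_eq inl_inj) //
      (inj_eq inr_inj) xpair_eqE (negPf ef).
  - exact: tri.
  - exact: trk.
  by move=> *; split.
- exfalso; apply: (noK i j) => //.
    by rewrite -F1 -F2; apply: etrans (uniq_catC [:: k; l] [:: i; j]) u.
  by rewrite -Af.
- exfalso; apply: (noK k l) => //; last by rewrite -Ae.
  by rewrite -E1 -E2.
- by move: u; rewrite E1 E2 F1 F2.
Qed.

(** Sending (x, y) to the crossing found on its line is injective: a crossing lies on only two
    edges, which give the values of the line at two distinct indices. *)
Lemma crossing_lower_bound : (p ^ 2 <= a)%N.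
Proof.
have [[x y]|f fP] := @choice ('F_p * 'F_p)%type plane (fun xy z =>
   let phi (e : 'I_9) := xy.1 + e%:R * xy.2 in
   exists k l e f, [/\ incident k e, incident l f, e != f,
    open_trace (arc d (thick_edge k e (phi e))) z &
    open_trace (arc d (thick_edge l f (phi f))) z]).
  exact: line_crossing.
have [cA _ _] := da.
have -> : (p ^ 2 = #|{: 'F_p * 'F_p}|)%N by rewrite card_prod card_Fp.
apply: (@finite_inj_card _ _ _ f _ cA) => [[x y] [x' y'] E|xy].
  have [k [l [e [g [ke lg eg ze zg]]]]] := fP (x, y).
  have [k' [l' [e' [g' [ke' lg' eg' ze' zg']]]]] := fP (x', y').
  rewrite -E /= in ze' zg'; rewrite /= in ze zg.
  have neq m h n m' h' n' : h != h' ->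
      thick_edge m h n != thick_edge m' h' n' :> {set thick_vertex p}.
    by move=> hh; apply: contra_neq hh => /thick_edge_inj[].
  have three h1 h2 h3 : h1 \in edges (thick_graph p) -> h2 \in edges (thick_graph p) ->
     h3 \in edges (thick_graph p) -> h1 != h2 ->
     open_trace (arc d h1) (f (x, y)) -> open_trace (arc d h2) (f (x, y)) ->
     open_trace (arc d h3) (f (x, y)) -> h3 = h1 \/ h3 = h2.
    move=> i1 i2 i3 n12 z1 z2 z3.
    have [->|n13] := eqVneq h3 h1; first by left.
    have [->|n23] := eqVneq h3 h2; first by right.
    have := @curves_no_three _ _ d (inl h1) (inl h2) (inl h3) i1 i2 i3.
    rewrite !(inj_eq inl_inj) n12 eq_sym n13 eq_sym n23 => /(_ isT isT isT).
    by move=> S0; exfalso; rewrite -[False]/(set0 (f (x, y))) -S0.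
  have ie := thick_edge_in (x + e%:R * y) ke.
  have ig := thick_edge_in (x + g%:R * y) lg.
  have ie' := thick_edge_in (x' + e'%:R * y') ke'.
  have ig' := thick_edge_in (x' + g'%:R * y') lg'.
  (* Two linear equations with distinct coefficients; the nine indices remain distinct modulo [p]
     because [p] is at least 9. *)
  have sol (h h' : 'I_9) : h != h' -> x + h%:R * y = x' + h%:R * y' ->
      x + h'%:R * y = x' + h'%:R * y' -> (x, y) = (x', y').
    move=> hh E1 E2.
    have : (h%:R - h'%:R) * (y - y') = 0 :> 'F_p.
      have -> : (h%:R - h'%:R) * (y - y') = (x + h%:R * y - (x' + h%:R * y'))
        - (x + h'%:R * y - (x' + h'%:R * y')) :> 'F_p by ring.
      by rewrite E1 E2 !subrr.
    move/eqP; rewrite mulf_eq0 !subr_eq0 => /orP[/eqP /(congr1 val)|/eqP yy].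
      rewrite /= !val_Fp_nat // !modn_small ?(leq_trans (ltn_ord _) p9) //.
      by move=> /val_inj E3; rewrite E3 eqxx in hh.
    by move: E1; rewrite yy => /addIr ->.
  case: (three _ _ _ ie ig ie' (neq _ _ _ _ _ _ eg) ze zg ze') => /thick_edge_inj[_ Ee Ei];
  case: (three _ _ _ ie ig ig' (neq _ _ _ _ _ _ eg) ze zg zg') => /thick_edge_inj[_ Eg Ej].
  - by rewrite Ee Eg eqxx in eg'.
  - by apply: (sol e g) => //; rewrite -?Ei -?Ej ?Ee ?Eg.
  - by apply: (sol e g) => //; rewrite -?Ei -?Ej ?Ee ?Eg.
  - by rewrite Ee Eg eqxx in eg'.
have [k [l [e [g [ke lg eg ze zg]]]]] := fP xy.
exists (thick_edge k e (xy.1 + e%:R * xy.2)), (thick_edge l g (xy.1 + g%:R * xy.2)).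
split=> //; try exact: thick_edge_in.
by apply: contra_neq eg => /thick_edge_inj[].
Qed.
End LowerBound.

(** * A planar drawing *)

Section Kites.
Variable R : realType.
Local Notation plane := (R * R)%type.

(* Hub 0 lies inside the triangle of the hubs 2, 3 and 4, hub 1 outside of it. *)
Definition hub_pos (k : nat) : plane :=
  match k with
  | 0 => (0, 10) | 1 => (0, 100) | 2 => (- 30, 0) | 3 => (30, 0) | _ => (0, 40)
  end.

(** The middle vertices for the edge [e] lie on the diagonal from this point along [kite_diag e].
    The coordinates are chosen so that the nine kites spanned by such a diagonal and the two end
    hubs have disjoint interiors. *)
Definition kite_base (e : nat) : plane :=
  match e with
  | 0 => (- 15, 4) | 1 => (15, 4) | 2 => (- 1, 25)
  | 3 => (- 16, 50) | 4 => (14, 50) | 5 => (- 1, 70)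
  | 6 => (0, - 1) | 7 => (- 15, 19) | _ => (15, 19)
  end.

Definition kite_diag (e : nat) : plane :=
  match e with 2 | 3 | 4 | 5 => (2, 0) | _ => (0, 2) end.

Definition kite_hub (e : nat) (b : bool) : nat :=
  match e with
  | 0 => if b then 0 else 2 | 1 => if b then 0 else 3 | 2 => if b then 0 else 4
  | 3 => if b then 1 else 2 | 4 => if b then 1 else 3 | 5 => if b then 1 else 4
  | 6 => if b then 2 else 3 | 7 => if b then 2 else 4 | _ => if b then 3 else 4
  end.

(* The union over [0 < s < l < 1] is the open triangle between the hub and the
   diagonal of kite [e]; the diagonal is [l = 1]. *)
Definition kite_point (e : nat) (b : bool) (l s : R) : plane :=
  let h := hub_pos (kite_hub e b) in
  let m := kite_base e in let w := kite_diag e in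
  (h.1 + l * (m.1 - h.1) + s * w.1, h.2 + l * (m.2 - h.2) + s * w.2).

(** For given kites and halves all coordinates are numerals, and a common point is a linear system
    in [l], [s], [l'], [s'] that [lra] refutes. *)
Lemma kites_disjoint e b l s e' b' l' s' : e != e' -> (e < 9)%N -> (e' < 9)%N ->
  0 < s -> s < l -> l <= 1 -> 0 < s' -> s' < l' -> l' <= 1 ->
  kite_point e b l s <> kite_point e' b' l' s'.
Proof.
wlog ee : e b l s e' b' l' s' / (e < e')%N => [W|_].
  rewrite neq_ltn => /orP[] ee e9 e9' *; first by apply: W; rewrite ?ltn_eqF.
  by apply: nesym; apply: W; rewrite ?ltn_eqF.
rewrite /kite_point => _ e9' s0 sl l1 s0' sl' l1' [].
case: e' ee e9' => [|[|[|[|[|[|[|[|[|e']]]]]]]]] // ee _;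
  case: e ee => [|[|[|[|[|[|[|[|e]]]]]]]] // _.
all: case: b; case: b' => /=; lra.
Qed.

(** The diagonal separates the two hubs; [l + l' < 2] excludes that both points are on it. *)
Lemma kite_halves_disjoint e b l s b' l' s' : b != b' -> l <= 1 -> l' <= 1 ->
  l + l' < 2 -> kite_point e b l s <> kite_point e b' l' s'.
Proof.
rewrite /kite_point => bb l1 l1' ll [].
do 8!(case: e => [|e]; first by case: b b' bb => -[] //= _; lra).
by case: b b' bb => -[] //= _; lra.
Qed.

Lemma kite_point_inj e b l s l' s' :
  kite_point e b l s = kite_point e b l' s' -> l = l' /\ s = s'.
Proof.
rewrite /kite_point => -[].
do 8!(case: e => [|e]; first by case: b => /=; lra).
by case: b => /=; lra.
Qed.

Lemma kite_point_hub e b l s k : (k < 5)%N -> 0 < s -> s < l -> l <= 1 ->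
  kite_point e b l s <> hub_pos k.
Proof.
rewrite /kite_point => k5 s0 sl l1.
case: k k5 => [|[|[|[|[|k]]]]] // _.
all: do 8!(case: e => [|e]; first by case: b => /= -[]; lra).
all: by case: b => /= -[]; lra.
Qed.

Lemma hub_pos_inj k l : (k < 5)%N -> (l < 5)%N -> hub_pos k = hub_pos l -> k = l.
Proof.
case: k => [|[|[|[|[|k]]]]] // _; case: l => [|[|[|[|[|l]]]]] // _ [] => *; exfalso; lra.
Qed.
End Kites.

Section PlanarDrawing.
Variables (R : realType) (p : nat).
Local Notation plane := (R * R)%type.

(** ['F_p] is the ordinal type of size [(Zp_trunc (pdiv p)).+2], so the denominator exceeds every
    [i.+1] and the values stay strictly between 0 and 1. *)
Definition diag_param (i : 'F_p) : R := i.+1%:R / (Zp_trunc (pdiv p)).+3%:R.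

Lemma diag_param_gt0 i : 0 < diag_param i.
Proof. by rewrite divr_gt0 ?ltr0n. Qed.

Lemma diag_param_lt1 i : diag_param i < 1.
Proof. by rewrite ltr_pdivrMr ?ltr0n // mul1r ltr_nat ltnS. Qed.

Lemma diag_param_inj : injective diag_param.
Proof.
move=> i j /mulIf; rewrite invr_eq0 pnatr_eq0 => /(_ isT) /eqP.
by rewrite eqr_nat => /eqP[] /val_inj.
Qed.

Definition thick_pos (v : thick_vertex p) : plane :=
  match v with
  | inl k => hub_pos R k
  | inr (e, i) => kite_point e true 1 (diag_param i)
  end.

Lemma kite_point1 e b b' (s : R) : kite_point e b 1 s = kite_point e b' 1 s.
Proof. by rewrite /kite_point; congr (_, _); ring. Qed.

Lemma thick_pos_inj : injective thick_pos.
Proof.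
have hk (k : 'I_5) e i : kite_point e true 1 (diag_param i) <> hub_pos R k.
  by apply: kite_point_hub => //; [exact: diag_param_gt0|exact: diag_param_lt1].
move=> [k|[e i]] [l|[f j]] /=.
- by move=> /hub_pos_inj -/(_ (ltn_ord k) (ltn_ord l)) /val_inj ->.
- by move=> /esym /hk.
- by move=> /hk.
have [->|ef] := eqVneq e f.
  by move=> /kite_point_inj[_ /diag_param_inj ->].
move=> /kites_disjoint; case=> //; try exact: ltn_ord.
all: by rewrite ?diag_param_gt0 ?diag_param_lt1.
Qed.

Lemma incident_kite_hub (k : 'I_5) (e : 'I_9) : incident k e ->
  exists b, k = kite_hub e b :> nat.
Proof.
rewrite /incident /ends => /orP[] /eqP->; [exists true|exists false];
  by case: e => [[|[|[|[|[|[|[|[|[|e]]]]]]]]] eP].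
Qed.

(** Straight segments, directed from the hub to the middle vertex. An edge is an unordered set, so
    its data are recovered by [pick], uniquely by [thick_edge_inj]; 0 is the value on sets that are
    no edges. *)
Definition thick_arc (E : {set thick_vertex p}) (t : R) : plane :=
  if [pick u : 'I_5 * 'I_9 * 'F_p | E == thick_edge u.1.1 u.1.2 u.2] is Some u
  then let h := thick_pos (inl u.1.1) in
       h + t *: (thick_pos (inr (u.1.2, u.2)) - h)
  else 0.

Lemma thick_arcE k e i t : thick_arc (thick_edge k e i) t =
  thick_pos (inl k) + t *: (thick_pos (inr (e, i)) - thick_pos (inl k)).
Proof.
rewrite /thick_arc; case: pickP => [[[k' e'] i'] /eqP /thick_edge_inj[-> -> ->] //|].
by move=> /(_ (k, e, i)); rewrite eqxx.
Qed.

Lemma thick_arc_kite (k : 'I_5) (e : 'I_9) b i t : k = kite_hub e b :> nat ->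
  thick_arc (thick_edge k e i) t = kite_point e b t (t * diag_param i).
Proof.
move=> kb; rewrite thick_arcE /= (kite_point1 e true b) kb /kite_point.
by congr (_, _); rewrite /= -![_ *: _]/(_ * _); ring.
Qed.

Lemma open_thick_arc E (z : plane) : E \in edges (thick_graph p) ->
  open_trace (thick_arc E) z ->
  exists k e i b t, [/\ E = thick_edge k e i, k = kite_hub e b :> nat, 0 < t < 1,
    0 < t * diag_param i < t & z = kite_point e b t (t * diag_param i)].
Proof.
move=> /edge_thick[k [e [i [ke ->]]]] [t /= /[!in_itv] /= tI <-].
have [b kb] := incident_kite_hub ke; exists k, e, i, b, t; split=> //.
  case/andP: tI => t0 t1.
  by rewrite mulr_gt0 ?diag_param_gt0 // gtr_pMr // diag_param_lt1.
exact: thick_arc_kite.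
Qed.

Lemma thick_arc_simple E : E \in edges (thick_graph p) -> simple_arc (thick_arc E).
Proof.
move=> /edge_thick[k [e [i [ke ->]]]].
have -> : thick_arc (thick_edge k e i) = fun t : R => thick_pos (inl k)
   + t *: (thick_pos (inr (e, i)) - thick_pos (inl k)).
  by apply: funext => t; rewrite thick_arcE.
split; first exact/continuous_subspaceT/segment_continuous.
move=> s t _ _ /addrI /eqP; rewrite -subr_eq0 -scalerBl scaler_eq0 !subr_eq0.
by move=> /orP[/eqP//|/eqP/thick_pos_inj].
Qed.

Lemma thick_arc_ends E : E \in edges (thick_graph p) -> exists u v : thick_graph p,
  [/\ E = [set u; v]%SET, thick_arc E 0 = thick_pos u & thick_arc E 1 = thick_pos v].
Proof.
move=> /edge_thick[k [e [i [ke ->]]]]; exists (inl k), (inr (e, i)).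
by rewrite !thick_arcE scale0r addr0 scale1r addrC subrK.
Qed.

Lemma thick_arc_avoids E : E \in edges (thick_graph p) ->
  forall v : thick_graph p, ~ open_trace (thick_arc E) (thick_pos v).
Proof.
move=> EG v /(open_thick_arc EG)[k [e [i [b [t [_ kb /andP[t0 t1] /andP[s0 st]]]]]]].
case: v => [l|[f j]] /=.
  by move=> /esym; apply: kite_point_hub => //; apply: ltW.
have [->|fe] := eqVneq f e.
  by rewrite (kite_point1 e true b) => /kite_point_inj[E1 _]; move: t1; rewrite E1 ltxx.
by apply: kites_disjoint; rewrite ?diag_param_gt0 ?diag_param_lt1 // ltW.
Qed.

Definition thick_drawing : graph_drawing R (thick_graph p) :=
  @GraphDrawing R (thick_graph p) thick_pos thick_arc
    thick_pos_inj thick_arc_simple thick_arc_ends thick_arc_avoids.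

(** Edges in different kites or in different halves of one kite are disjoint; two edges in the same
    half leave the hub in different directions. *)
Lemma thick_planar : planar R (thick_graph p).
Proof.
exists thick_drawing => E F EG FG EF; apply/seteqP; split=> // z [].
move=> /(open_thick_arc EG)[k [e [i [b [t [EE kb /andP[t0 t1] /andP[s0 st] ->]]]]]].
move=> /(open_thick_arc FG)[l [f [j [c [u [FE lc /andP[u0 u1] /andP[r0 ru]]]]]]].
have [ef|ef] := eqVneq e f; last first.
  by apply: kites_disjoint => //; apply: ltW.
subst f; have [bc|bc] := eqVneq b c; last first.
  by apply: kite_halves_disjoint => //; rewrite ?ltW //; lra.
subst c => /kite_point_inj[tu]; rewrite tu => /mulfI.
rewrite gt_eqF // => /(_ isT) /diag_param_inj ij.
move/eqP: EF; rewrite EE FE ij => EF; apply: EF; congr thick_edge.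
by apply: val_inj; rewrite /= kb lc.
Qed.
End PlanarDrawing.

(** * The family over growing primes and its constant *)

Theorem theorem7 (R : realType) :
  exists F : nat -> clustered_graph,
    [/\ forall k, [/\ c_connected (F k), flat (F k) & planar R (F k)],
        forall N : nat, exists k : nat, (N <= #|F k|)%N &
        exists c : R, exists n0 : nat, 0 < c /\
          forall k, (n0 <= #|F k|)%N ->
          forall (d : drawing R (F k)) (a : nat), drawing_a00 d a ->
            c * (#|F k|%:R) ^+ 2 <= a%:R].
Proof.
(* The shift by 9 keeps the nine edge indices distinct modulo [q k], and the primes are
   unbounded. *)
pose q k := s2val (prime_above (k + 9)).
have q_gt k : (k + 9 < q k)%N by rewrite /q; case: prime_above.
have q_prime k : prime (q k) by rewrite /q; case: prime_above.
exists (fun k => thick_clustered (q k)); split.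
- by move=> k; split;
    [exact: thick_c_connected|exact: thick_flat|exact: thick_planar].
- by move=> N; exists N; rewrite card_thick //; have := q_gt N; lia.
(* The graph has 5 + 9p vertices, at most 10p, so p^2 is at least a hundredth of the squared
   order. *)
exists (100^-1), 0%N; split; first by rewrite invr_gt0.
move=> k _ d a da; rewrite card_thick //.
have q9 : (9 <= q k)%N by have := q_gt k; lia.
have := crossing_lower_bound (q_prime k) q9 da.
rewrite -(ler_nat R); apply: le_trans; rewrite ler_pdivrMl // natrX.
have -> : 100 * (q k)%:R ^+ 2 = (10 * q k)%:R ^+ 2 :> R by rewrite natrM; ring.
rewrite ler_pXn2r ?nnegrE // ler_nat; lia.
Qed.
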